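(* Let $(\mathbf X,\mathbf d)$ and $\mathcal E:\mathbf X\to\mathbb R\cup\{\infty\}$ satisfy the standing assumptions (E1)–(E3) and the normalization stated in the context, and let $u^0\in\mathbf X$. Let $(\tau_n)_{n\in\mathbb N}$ be a strictly decreasing sequence of step sizes $\tau_n\in(0,\tau_* )$ with $\tau_n\to0$ such that every quotient $\tau_n/\tau_{n+1}$ is a natural number. For each $n$ let initial data $(u_{\tau_n}^{-1},u_{\tau_n}^{0})\in\mathbf X\times\mathbf X$ be given, and assume that there are constants $K_0,K_1,K_2,K_3$, independent of $n$, such that for all $n$: (I0) $\mathbf d(u_{\tau_n}^0,u^0)\le K_0\tau_n$; (I1) $\mathcal E(u_{\tau_n}^0)\le K_1$ and $\mathcal E(u_{\tau_n}^{-1})\le K_1$; (I2) $\mathbf d(u_{\tau_n}^{-1},u_{\tau_n}^0)\le K_2\tau_n$; and in addition $\mathbf d(u_{\tau_n}^0,u^0)\le K_3\tau_n$. Then for each $n$ the associated discrete solution $(u_{\tau_n}^k)_{k\in\mathbb N}$ is well-defined (i.e. it exists and is unique), and the sequence of piecewise constant interpolations $(\bar u_{\tau_n})_{n\in\mathbb N}$ converges, locally uniformly with respect to time on $[0,\infty)$, to a solution $u_*\in \mathrm{AC}^2([0,\infty),\mathbf X)$ of the gradient flow for $\mathcal E$ with initial condition $u^0$, i.e. $u_*(0)=u^0$ and $$\tfrac12\mathbf d^2(u_*(t),w)-\tfrac12\mathbf d^2(u_*(s),w)\le\int_s^t\Big[\mathcal E(w)-\mathcal E(u_*(r))-\tfrac\lambda2\mathbf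 d^2(u_*(r),w)\Big]\,dr$$ for all $0\le s\le t$ and every $w\in\mathcal D(\mathcal E)$. More precisely, for every time horizon $T>0$ there is a constant $C$, expressible in terms of $K_0,K_1,K_2,K_3$ and $T$ alone (the data $(\mathbf X,\mathbf d)$, $\mathcal E$, $\lambda$, $\tau_*$, $x_*$, $c_*$, $u^0$ being fixed), such that for all $n$ and all $t\in[0,T]$ $$\mathbf d\big(\bar u_{\tau_n}(t),u_*(t)\big)\le C\sqrt{\tau_n}.$$
   Context: $(\mathbf X,\mathbf d)$ is a separable and complete metric space, $\mathcal E:\mathbf X\to\mathbb R\cup\{\infty\}$ has nonempty domain $\mathcal D(\mathcal E)=\{w:\mathcal E(w)<\infty\}$, and $\mathbb N=\{1,2,\dots\}$. BDF2 penalization: for $\tau>0$ and $u,v,w\in\mathbf X$, $$\Psi(\tau,u,v;w):=\frac1\tau\mathbf d^2(v,w)-\frac1{4\tau}\mathbf d^2(u,w)+\mathcal E(w).$$ Standing assumptions: (E1) $\mathcal E$ is sequentially lower semicontinuous on $(\mathbf X,\mathbf d)$. (E2) There are $\tau_*>0$ and $x_*\in\mathbf X$ with $c_*:=\inf_{v\in\mathbf X}\big(\frac1{2\tau_*}\mathbf d^2(x_*,v)+\mathcal E(v)\big)>-\infty$. (E3) There is a constant $\lambda\in\mathbb R$ such that for every $u,v,\gamma_0,\gamma_1\in\mathcal D(\mathcal E)$ and every $\tau\in(0,\tau_* )$ there is a continuous curve $\gamma_{(\cdot)}:[0,1]\to\mathbf X$ joining $\gamma_0$ to $\gamma_1$ such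 that for all $s\in[0,1]$ $$\Psi(\tau,u,v;\gamma_s)\le(1-s)\Psi(\tau,u,v;\gamma_0)+s\Psi(\tau,u,v;\gamma_1)-\tfrac12\Big(\tfrac3{2\tau}+\lambda\Big)s(1-s)\mathbf d^2(\gamma_0,\gamma_1).$$ Normalization: $\lambda\le0$ and $(-\lambda)\tau_*\le\frac12$. Discrete solution: for $\tau\in(0,\tau_* )$ and initial data $(u_\tau^{-1},u_\tau^0)$, it is the sequence $(u_\tau^k)_{k\in\mathbb N}$ defined inductively by $u_\tau^k\in\operatorname{argmin}_{w\in\mathbf X}\Psi(\tau,u_\tau^{k-2},u_\tau^{k-1};w)$, $k\in\mathbb N$. Its piecewise constant interpolation is $\bar u_\tau:[0,\infty)\to\mathbf X$ with $\bar u_\tau(0)=u^0$ and $\bar u_\tau(t)=u_\tau^k$ for $t\in((k-1)\tau,k\tau]$, $k\in\mathbb N$. A curve $u:[0,\infty)\to\mathbf X$ belongs to $\mathrm{AC}^2([0,\infty),\mathbf X)$ if there is $m\in L^2_{\mathrm{loc}}([0,\infty))$ with $\mathbf d(u(t),u(s))\le\int_s^tm(r)\,dr$ for all $0\le s\le t$. *)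

(* Defs.v *)
From HB Require Import structures.
From mathcomp Require Import all_boot all_order all_algebra.
From mathcomp Require Import all_classical all_reals all_analysis.

Set Implicit Arguments.
Unset Strict Implicit.
Unset Printing Implicit Defensive.

Import Order.TTheory GRing.Theory Num.Theory.
Import numFieldTopology.Exports numFieldNormedType.Exports.

Local Open Scope classical_set_scope.
Local Open Scope ring_scope.

(* Completeness comes from the library's Complete class, which also requires
   a distinguished point; the point carries no mathematical content here. *)
#[short(type="completeMetricType")]
HB.structure Definition CompleteMetric (R : numDomainType) :=
  {T of Complete T & Metric R T}.

Definition separable (T : topologicalType) : Prop :=
  exists2 D : set T, countable D & dense D.

(* Energies take values in R together with +oo; the value -oo of \bar R is
   excluded by a hypothesis of the theorem. *)
Definition domain {R : realType} {X : Type} (E : X -> \bar R) : set X :=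
  [set w | (E w < +oo)%E].

Definition seq_lower_semicontinuous {R : realType} {X : topologicalType}
    (E : X -> \bar R) : Prop :=
  forall (v : nat -> X) (w : X),
    v n @[n --> \oo] --> w -> (E w <= limn_einf (fun n => E (v n)))%E.

Definition argmin {R : realType} {X : Type} (f : X -> \bar R) : set X :=
  [set w | forall z, (f w <= f z)%E].

Section BDF2.
Context {R : realType} {X : metricType R}.
Implicit Types (E : X -> \bar R) (tau : R) (u v w : X).

Definition bdf2_penalization E tau u v w : \bar R :=
  ((mdist v w ^+ 2 / tau - mdist u w ^+ 2 / (4 * tau))%:E + E w)%E.

Definition coercivity_constant E tau (x : X) : \bar R :=
  ereal_inf (range (fun v => ((mdist x v ^+ 2 / (2 * tau))%:E + E v)%E)).

Definition bdf2_convex E (lambda tau_max : R) : Prop :=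
  forall u v g0 g1, domain E u -> domain E v -> domain E g0 -> domain E g1 ->
  forall tau, 0 < tau < tau_max ->
  exists g : R -> X,
    [/\ {within `[0, 1], continuous g}, g 0 = g0, g 1 = g1 &
        forall s, 0 <= s <= 1 ->
          (bdf2_penalization E tau u v (g s) <=
             (1 - s)%:E * bdf2_penalization E tau u v g0
             + s%:E * bdf2_penalization E tau u v g1
             - (2^-1 * (3 / (2 * tau) + lambda) * s * (1 - s)
                * mdist g0 g1 ^+ 2)%:E)%E].

(* [U k] is the k-th iterate for k >= 0; the datum with index -1 is [um1]. *)
Definition discrete_solution E tau (um1 u0 : X) (U : nat -> X) : Prop :=
  U 0%N = u0 /\
  forall k : nat,
    argmin (bdf2_penalization E tau (if k is j.+1 then U j else um1) (U k))
           (U k.+1).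

(* The value x0 at time 0 is prescribed separately from the sequence U.
   For t in ](k - 1) tau, k tau], the ceiling of t / tau is k. *)
Definition piecewise_constant tau (x0 : X) (U : nat -> X) (t : R) : X :=
  if t <= 0 then x0 else U (absz (Num.ceil (t / tau))).

End BDF2.

Definition L2_loc {R : realType} (m : R -> R) : Prop :=
  measurable_fun (`[0, +oo[ : set R) m /\
  forall T : R, 0 < T ->
    (\int[lebesgue_measure]_(r in `[0%R, T]) ((m r) ^+ 2)%:E < +oo)%E.

Section curves.
Context {R : realType} {X : metricType R}.

Definition AC2 (u : R -> X) : Prop :=
  exists2 m : R -> R, L2_loc m &
    forall s t : R, 0 <= s -> s <= t ->
      ((mdist (u t) (u s))%:E
         <= \int[lebesgue_measure]_(r in `[s, t]) (m r)%:E)%E.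

(* Extended-real integral: E (u r) may be +oo for r in a negligible set. *)
Definition gradient_flow (E : X -> \bar R) (lambda : R) (u0 : X)
    (u : R -> X) : Prop :=
  u 0 = u0 /\
  forall (s t : R) (w : X), 0 <= s -> s <= t -> domain E w ->
    ((2^-1 * mdist (u t) w ^+ 2 - 2^-1 * mdist (u s) w ^+ 2)%:E
       <= \int[lebesgue_measure]_(r in `[s, t])
            (E w - E (u r) - (lambda / 2 * mdist (u r) w ^+ 2)%:E))%E.

End curves.

(* Main.v *)
Require Import Defs.
From HB Require Import structures.
From mathcomp Require Import all_boot all_order all_algebra.
From mathcomp Require Import all_classical all_reals all_analysis.
From mathcomp Require Import measurable_realfun.
From mathcomp Require Import ring lra.

Import Order.TTheory GRing.Theory Num.Theory.
Import numFieldTopology.Exports numFieldNormedType.Exports.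

Local Open Scope classical_set_scope.
Local Open Scope ring_scope.

(** Write d for the distance, mu = - lambda, U_k for the iterates of a discrete
    solution with step tau, and d_k for the distance from U_(k-1) to U_k.

    Minimizers.  Along the curves of the convexity hypothesis the penalization
    is uniformly convex, and coercivity bounds it from below; so minimizing
    sequences are Cauchy, their limit is a minimizer by lower semicontinuity,
    and it is unique.  Comparing the minimizer with nearby points of the curve
    that joins it to an arbitrary w gives one inequality per step
    ([argmin_le], [bdf2_evi]): with P_k = 3/4 d^2(U_k, w) - 1/4 d^2(U_(k-1), w),
      P_k - P_(k-1) <= tau (E w - E U_k) + tau mu / 2 d^2(U_k, w)
                       + 1/2 d_(k-1)^2 - 1/2 d_k^2.
    For w = U_(k-1) it says that E(U_k) + d_k^2 / (4 tau) does not increase.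
    With coercivity and a Gronwall argument this bounds, on bounded time
    intervals, the iterates, their energies and the sum of d_k^2 / tau.

    Rate.  The increment of d^2(U_k, w) is 4/3 of that of P_k plus a third of
    the preceding increment.  Iterating, every w satisfies the inequality of the
    implicit Euler scheme up to an error ([perturbed_euler]),
      d^2(U_k, w) - d^2(U_(k-1), w)
        <= 2 tau (E w - E U_k) + 2 mu tau d^2(U_k, w) + theta_k,
    where the theta_k are nonnegative with sum O(tau).  Let V be a solution with
    step eta = tau / m.  From the time (j-1) tau to j tau, V makes m steps,
    tested against w = U_j; then U makes one step, tested against
    w = V_((j-1)m).  In the sum the energies of U cancel, and those of V contribute tau times the
    energy that V dissipates in the block, up to the increments of V.  Hence
    d^2(U_j, V_(jm)) = O(tau) by Gronwall ([comparison]), the interpolations are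
    Cauchy, and the distance to their limit u is O(sqrt tau).

    Limit.  Summing the inequalities for P_k keeps the constant lambda / 2; the
    Fatou lemma and lower semicontinuity turn the sum into the evolution
    variational inequality of u ([limit_evi]).  The comparison with m = 1 of a
    solution with its own time shift becomes the contraction
      d^2(u(t), u(t+h)) <= exp(12 mu (t-s)) d^2(u(s), u(s+h)),   s <= t.
    So the difference quotients of u, suitably weighted, increase when the step
    is halved; their limit is a speed of u, and it is locally square integrable
    because the sum of d^2(u(ih), u((i+1)h)) / h stays bounded
    ([AC2_of_contraction]). *)

(** * Gronwall inequalities *)

(** The source term is given by its primitive W. *)
Lemma gronwall_step (R : realType) (b : R) (D W : nat -> R) (N : nat) :
  0 <= b -> (forall j, (j < N)%N -> W j <= W j.+1) ->
  (forall j, (j < N)%N -> D j.+1 <= (1 + b) * D j + (W j.+1 - W j)) ->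
  D N <= (1 + b) ^+ N * (D 0%N + (W N - W 0%N)).
Proof.
move=> b0; elim: N => [|N IH] hW hD; first by rewrite expr0 mul1r subrr addr0.
have {}IH := IH (fun j hj => hW j (ltnW hj)) (fun j hj => hD j (ltnW hj)).
have hN := hD N (ltnSn N); have hWN := hW N (ltnSn N).
have p1 : 1 <= (1 + b) ^+ N.+1 by rewrite exprn_ege1// lerDl.
rewrite exprS in p1 *.
have : (1 + b) * D N <= (1 + b) * ((1 + b) ^+ N * (D 0%N + (W N - W 0%N))).
  by rewrite ler_wpM2l// addr_ge0.
have : (W N.+1 - W N) <= ((1 + b) * (1 + b) ^+ N) * (W N.+1 - W N).
  by rewrite ler_peMl// subr_ge0.
set q := (1 + b) ^+ N.
nra.
Qed.

Lemma gronwall_sum (R : realType) (A b : R) (a : nat -> R) (N : nat) :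
  0 <= b -> (forall n, (n <= N)%N -> a n <= A + b * \sum_(k < n) a k) ->
  a N <= A * (1 + b) ^+ N.
Proof.
move=> b0 ha.
suff H : forall n, (n <= N)%N -> A + b * \sum_(k < n) a k <= A * (1 + b) ^+ n.
  by apply: le_trans (ha N (leqnn N)) _; exact: H.
elim=> [|n IH] hn; first by rewrite big_ord0 expr0 mulr0 addr0 mulr1.
have h1 := IH (ltnW hn); have h2 := ha n (ltnW hn).
rewrite big_ord_recr /= exprS.
have h3 : b * a n <= b * (A * (1 + b) ^+ n).
  by rewrite ler_wpM2l//; exact: le_trans h1.
lra.
Qed.

Lemma exprn_le_expR (R : realType) (b : R) (N : nat) :
  0 <= b -> (1 + b) ^+ N <= expR (b * N%:R).
Proof.
move=> b0; rewrite expRM_natr.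
by rewrite lerXn2r// ?nnegrE ?expR_ge0 ?addr_ge0// expR_ge1Dx.
Qed.

(** * Squared distances along discrete paths *)

Section metric.
Context {R : realType} {X : metricType R}.
Implicit Types (x y z : X) (V Z : nat -> X).

Lemma sqr_mdist_triangle y x z :
  mdist x z ^+ 2 <= 2 * mdist x y ^+ 2 + 2 * mdist y z ^+ 2.
Proof.
have := metric_triangle x y z; have := mdist_ge0 x z.
have := mdist_ge0 x y; have := mdist_ge0 y z.
have := sqr_ge0 (mdist x y - mdist y z).
nra.
Qed.

(** Sum of the squared lengths of the first n edges of a path. *)
Definition path_energy Z (n : nat) : R :=
  \sum_(i < n) mdist (Z i) (Z i.+1) ^+ 2.

Lemma path_energy0 Z : path_energy Z 0 = 0.
Proof. by rewrite /path_energy big_ord0. Qed.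

Lemma path_energyS Z n :
  path_energy Z n.+1 = path_energy Z n + mdist (Z n) (Z n.+1) ^+ 2.
Proof. by rewrite /path_energy big_ord_recr. Qed.

Lemma le_path_energy Z m n : (m <= n)%N -> path_energy Z m <= path_energy Z n.
Proof.
move=> /subnK <-; elim: (n - m)%N => [//|k IH].
by rewrite addSn path_energyS (le_trans IH)// lerDl sqr_ge0.
Qed.

Lemma path_energy_ge0 Z n : 0 <= path_energy Z n.
Proof. by rewrite -(path_energy0 Z) le_path_energy. Qed.

Lemma path_energy_shift Z a n :
  path_energy (fun k => Z (a + k)%N) n
    = path_energy Z (a + n) - path_energy Z a.
Proof.
elim: n => [|n IH]; first by rewrite path_energy0 addn0 subrr.
by rewrite path_energyS IH !addnS path_energyS addrAC.
Qed.

(** Cauchy-Schwarz for the triangle inequality along l consecutive edges. *)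
Lemma sqr_mdist_path Z a l :
  mdist (Z a) (Z (a + l)%N) ^+ 2
    <= l%:R * (path_energy Z (a + l) - path_energy Z a).
Proof.
elim: l => [|l IH]; first by rewrite addn0 mdistxx expr0n /= mul0r.
rewrite addnS path_energyS.
have tri := metric_triangle (Z a) (Z (a + l)%N) (Z (a + l).+1).
case: l => [|l] in IH tri *.
  by rewrite addn0 mul1r addrC addKr.
set L := (l.+1)%:R : R in IH *.
have L0 : 0 < L by rewrite ltr0n.
rewrite (_ : l.+2%:R = L + 1); last by rewrite -natr1.
set P := path_energy _ (a + _) in IH *; set P0 := path_energy _ a in IH *.
move: IH tri; set p := mdist (Z a) (Z (a + l.+1)%N).
set q := mdist (Z (a + l.+1)%N) (Z (a + l.+1).+1).
set r := mdist (Z a) (Z (a + l.+1).+1) => IH tri.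
have p0 : 0 <= p := mdist_ge0 _ _.
have q0 : 0 <= q := mdist_ge0 _ _.
have r0 : 0 <= r := mdist_ge0 _ _.
(* Expand (p + q) ^ 2: here 2 p q <= p ^ 2 / L + L q ^ 2, and p ^ 2 / L is at
   most P - P0 by induction. *)
have h1 : p ^+ 2 / L <= P - P0 by rewrite ler_pdivrMr// mulrC.
have h2 : 2 * p * q <= p ^+ 2 / L + L * q ^+ 2.
  rewrite -subr_ge0 (_ : _ - _ = (p - L * q) ^+ 2 / L).
    by rewrite divr_ge0// ?sqr_ge0// ltW.
  by field; lra.
have h3 : r ^+ 2 <= (p + q) ^+ 2 by rewrite lerXn2r// ?nnegrE ?addr_ge0.
clearbody L P P0 p q r; lra.
Qed.

End metric.

(** * Convergence of sequences and lower semicontinuity *)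

Section metric_limits.
Context {R : realType} {X : metricType R}.
Implicit Types (v w : nat -> X) (x y : X).

Lemma cvg_mdistP v x :
  v n @[n --> \oo] --> x <-> mdist (v n) x @[n --> \oo] --> (0 : R).
Proof.
split.
  move=> /metricType_numDomainType.cvgrPdist_lt h.
  apply/cvgrPdist_lt => eps /h; apply: filterS => n.
  by rewrite sub0r normrN ger0_norm ?mdist_ge0// metric_sym.
move=> /cvgrPdist_lt h; apply/metricType_numDomainType.cvgrPdist_lt => eps /h.
by apply: filterS => n; rewrite sub0r normrN ger0_norm ?mdist_ge0// metric_sym.
Qed.

Lemma ler_dist_mdist x y x' y' :
  `|mdist x y - mdist x' y'| <= mdist x x' + mdist y y'.
Proof.
rewrite ler_norml.
have := metric_triangle x x' y; have := metric_triangle x' y' y.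
have := metric_triangle x' x y'; have := metric_triangle x y y'.
by rewrite (metric_sym y' y) (metric_sym x' x); lra.
Qed.

Lemma cvg_mdist v w x y :
  v n @[n --> \oo] --> x -> w n @[n --> \oo] --> y ->
  mdist (v n) (w n) @[n --> \oo] --> mdist x y.
Proof.
move=> /cvg_mdistP hv /cvg_mdistP hw.
apply/subr_cvg0/norm_cvg0P.
apply: (@squeeze_cvgr _ _ _ _ (fun=> 0)
  (fun n => mdist (v n) x + mdist (w n) y)).
- by near=> n; rewrite normr_ge0/= ler_dist_mdist.
- exact: cvg_cst.
- by rewrite -[X in _ --> X](addr0 0); exact: cvgD.
Unshelve. all: by end_near. Qed.

(** Sublevel sets of a sequentially lower semicontinuous function are
    sequentially closed. *)
Lemma seq_lsc_le (E : X -> \bar R) v x (c : \bar R) :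
  seq_lower_semicontinuous E -> v n @[n --> \oo] --> x ->
  (\forall n \near \oo, (E (v n) <= c)%E) -> (E x <= c)%E.
Proof.
move=> hE vx hc; apply: le_trans (hE _ _ vx) _.
apply: le_trans (limn_einf_sup _) _; rewrite limn_esup_lim.
apply: lime_le; first exact: is_cvg_esups.
case: hc => N _ hN; exists N => // n /= Nn.
apply: ge_ereal_sup => _ [k /= nk <-]; apply: hN => /=; exact: leq_trans nk.
Qed.

End metric_limits.

Lemma cauchy_mdist_cvg (R : realType) (X : completeMetricType R)
    (v : nat -> X) :
  (forall eps : R, 0 < eps -> exists N, forall n k, (N <= n)%N -> (N <= k)%N ->
     mdist (v n) (v k) < eps) ->
  exists z : X, v n @[n --> \oo] --> z.
Proof.
move=> hv; suff : cvgn v by move=> cv; exists (limn v).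
apply/cauchy_cvgP/cauchy_exP => eps eps0; have [N hN] := hv _ eps0.
by exists (v N), N => // n /= Nn; rewrite ballEmdist /=; exact: hN.
Qed.

Lemma cvg_sqr (R : realType) (f : nat -> R) (a : R) :
  f n @[n --> \oo] --> a -> f n ^+ 2 @[n --> \oo] --> a ^+ 2.
Proof.
by move=> fa; rewrite expr2; under eq_fun do rewrite expr2; exact: cvgM.
Qed.

Lemma ler_cvgn (R : realType) (f g : nat -> R) (a b : R) :
  f n @[n --> \oo] --> a -> g n @[n --> \oo] --> b ->
  (\forall n \near \oo, f n <= g n) -> a <= b.
Proof. exact: ler_cvg_to. Qed.

Lemma cvg_sqr0 (R : realType) (f g : nat -> R) :
  (\forall n \near \oo, 0 <= f n /\ f n ^+ 2 <= g n) ->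
  g n @[n --> \oo] --> (0 : R) -> f n @[n --> \oo] --> (0 : R).
Proof.
move=> fg g0; apply/cvgrPdist_lt => eps eps0.
have e2 : 0 < eps ^+ 2 by rewrite exprn_gt0.
have /cvgrPdist_lt/(_ _ e2) h := g0.
near=> n.
have [f0 fgn] : 0 <= f n /\ f n ^+ 2 <= g n by near: n.
have : `|0 - g n| < eps ^+ 2 by near: n.
rewrite !sub0r !normrN (ger0_norm f0) => /(le_lt_trans (ler_norm _)) gn.
by rewrite -(@ltr_pXn2r _ 2) ?nnegrE ?(ltW eps0)//; exact: le_lt_trans gn.
Unshelve. all: by end_near. Qed.
Lemma near_le_cvg {R : realType} (f : nat -> R) a b :
  f n @[n --> \oo] --> a -> a < b -> \forall n \near \oo, f n <= b.
Proof.
move=> fa ab; have ba : 0 < b - a by rewrite subr_gt0.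
have /cvgrPdist_lt/(_ _ ba) := fa; apply: filterS => n.
by rewrite ltr_norml => /andP[]; lra.
Qed.

Lemma limn_einf_ge (R : realType) (v : nat -> \bar R) (c : \bar R) :
  (\forall n \near \oo, (c <= v n)%E) -> (c <= limn_einf v)%E.
Proof.
move=> [N _ hN]; rewrite limn_einf_lim; apply: lime_ge.
  exact: is_cvg_einfs.
exists N => // n /= Nn; apply: le_ereal_inf_tmp => _ [k /= nk <-].
by apply: hN => /=; exact: leq_trans nk.
Qed.

Lemma limn_einf_gt (R : realType) (v : nat -> \bar R) (c : \bar R) :
  (c < limn_einf v)%E -> \forall n \near \oo, (c < v n)%E.
Proof.
move=> h; have [n hn] : exists n, (c < einfs v n)%E.
  apply/not_existsP => hn; move: h; apply/negP; rewrite -leNgt limn_einf_lim.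
  apply: lime_le; first exact: is_cvg_einfs.
  by apply: nearW => n; rewrite leNgt; apply/negP/hn.
exists n => // k /= nk; apply: lt_le_trans hn _.
by apply: ereal_inf_lbound; exists k.
Qed.

Lemma seq_lsc_gt (R : realType) (X : metricType R) (E : X -> \bar R)
    (v : nat -> X) (x : X) (c : \bar R) :
  seq_lower_semicontinuous E -> v n @[n --> \oo] --> x -> (c < E x)%E ->
  \forall n \near \oo, (c < E (v n))%E.
Proof.
by move=> hE vx cx; apply: limn_einf_gt; apply: lt_le_trans cx (hE _ _ vx).
Qed.

Lemma seq_lsc_near (R : realType) (X : metricType R) (E : X -> \bar R)
    (x : X) (c : \bar R) :
  seq_lower_semicontinuous E -> (c < E x)%E ->
  exists2 d : R, 0 < d & forall z, mdist x z < d -> (c < E z)%E.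
Proof.
move=> hE cx; apply: contrapT => h.
have /choice[z hz] : forall n : nat, exists z,
    mdist x z < n.+1%:R^-1 /\ (E z <= c)%E.
  move=> n; apply: contrapT => hn; apply: h.
  exists (n.+1%:R^-1); first by rewrite invr_gt0.
  move=> z xz; rewrite ltNge; apply/negP => zc; apply: hn.
  by exists z.
have zx : z n @[n --> \oo] --> x.
  apply/metricType_numDomainType.cvgrPdist_lt => eps eps0.
  near=> n; apply: (lt_trans (hz n).1).
  near: n; exact: near_infty_natSinv_lt (PosNum eps0).
have : (E x <= c)%E.
  by apply: (seq_lsc_le _ _ _ _ hE zx); apply: nearW => n; exact: (hz n).2.
by rewrite leNgt cx.
Unshelve. all: by end_near. Qed.

(** * A priori estimates for BDF2 trajectories *)

Section trajectory.
Context {R : realType} {X : metricType R}.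
Variables (dom : set X) (e : X -> R).

(** A sequence indexed from 0 that carries the discrete variational inequality
    of BDF2: [Z 0] and [Z 1] are the two initial data, [Z k.+2] is the minimizer
    computed from [Z k] and [Z k.+1], [e] is the energy on [dom], and
    [mu = - lambda].  The inequality is multiplied by the step. *)
Definition bdf2_trajectory (tau mu : R) (Z : nat -> X) : Prop :=
  (forall k, dom (Z k)) /\
  forall k w, dom w ->
    3 / 4 * mdist (Z k.+2) w ^+ 2 - mdist (Z k.+1) w ^+ 2
      + 1 / 4 * mdist (Z k) w ^+ 2
    <= tau * (e w - e (Z k.+2)) + tau * mu / 2 * mdist (Z k.+2) w ^+ 2
       - mdist (Z k.+1) (Z k.+2) ^+ 2 + 1 / 4 * mdist (Z k) (Z k.+2) ^+ 2.

Variables (tau mu : R) (Z : nat -> X).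
Hypotheses (tau0 : 0 < tau) (mu0 : 0 <= mu) (mutau : mu * tau <= 1 / 2).
Hypothesis trajZ : bdf2_trajectory tau mu Z.

Let inc k := mdist (Z k) (Z k.+1) ^+ 2.

Let inc_ge0 k : 0 <= inc k.
Proof. exact: sqr_ge0. Qed.

Lemma bdf2_evi k w : dom w ->
  3 / 4 * mdist (Z k.+2) w ^+ 2 - mdist (Z k.+1) w ^+ 2
    + 1 / 4 * mdist (Z k) w ^+ 2
  <= tau * (e w - e (Z k.+2)) + tau * mu / 2 * mdist (Z k.+2) w ^+ 2
     + 1 / 2 * inc k - 1 / 2 * inc k.+1.
Proof.
move=> dw; have := trajZ.2 k w dw.
have := sqr_mdist_triangle (Z k.+1) (Z k) (Z k.+2); rewrite /inc; lra.
Qed.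

Lemma bdf2_dissipation_step k :
  tau * e (Z k.+2) + inc k.+1 <= tau * e (Z k.+1) + 1 / 4 * inc k.
Proof.
have := bdf2_evi k (Z k.+1) (trajZ.1 _).
rewrite mdistxx (metric_sym (Z k.+2)) -/(inc _) -/(inc _) expr0n /=.
have : tau * mu / 2 * inc k.+1 <= 1 / 4 * inc k.+1.
  by rewrite ler_wpM2r ?inc_ge0//; move: mutau; lra.
lra.
Qed.

Lemma bdf2_dissipation k :
  tau * e (Z k.+1) + 1 / 4 * inc k + 3 / 4 * path_energy Z k.+1
    <= tau * e (Z 1) + inc 0.
Proof.
elim: k => [|k IH]; first by rewrite path_energyS path_energy0 -/(inc _); lra.
have := bdf2_dissipation_step k.
by rewrite path_energyS -/(inc _); lra.
Qed.

(** A priori bound.  The factor 6 absorbs the term 5/6 d^2(x, Z N.+1) that comes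
    from the coercivity bound on the energy. *)
Lemma bdf2_bound (tmax c K : R) (x : X) (N : nat) :
  tau < tmax -> (forall w, dom w -> c <= mdist x w ^+ 2 / (2 * tmax) + e w) ->
  tau * e (Z 1) + inc 0 <= tau * K ->
  mdist x (Z N.+1) ^+ 2
    <= (6 * mdist x (Z 1) ^+ 2 + 10 * tmax * (K - c))
       * (1 + 24 * (tau / tmax)) ^+ N.
Proof.
have t0 := tau0; move=> taut hc hK; have tmax0 : 0 < tmax by lra.
pose a k := mdist x (Z k.+1) ^+ 2.
have hinc n : a n <= a 0%N + (1 + tmax / (4 * tau)) * path_energy Z n.+1
                    + 4 * (tau / tmax) * \sum_(k < n) a k.
  elim: n => [|n IH].
    rewrite big_ord0 mulr0 addr0 lerDl mulr_ge0// ?path_energy_ge0//.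
    by rewrite addr_ge0// divr_ge0//; lra.
  rewrite big_ord_recr path_energyS /= -/(inc _).
  suff : a n.+1 <= a n + (1 + tmax / (4 * tau)) * inc n.+1
         + 4 * (tau / tmax) * a n by lra.
  rewrite /a /inc; have := metric_triangle x (Z n.+1) (Z n.+2).
  set p := mdist x (Z n.+1); set q := mdist (Z n.+1) (Z n.+2);
  set r := mdist x (Z n.+2) => tri.
  have h : 2 * p * q <= tmax / (4 * tau) * q ^+ 2 + 4 * (tau / tmax) * p ^+ 2.
    rewrite -subr_ge0 (_ : _ - _ =
      (tmax * q - 4 * tau * p) ^+ 2 / (4 * tau * tmax)); last first.
      by field; apply/andP; split; lra.
    by rewrite divr_ge0// ?sqr_ge0// mulr_ge0//; lra.
  have : r ^+ 2 <= (p + q) ^+ 2.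
    by rewrite lerXn2r// ?nnegrE ?addr_ge0 ?mdist_ge0.
  lra.
(* Young's inequality above has weight tmax / 4, so that the factor of
   path_energy / tau, multiplied by 4/3 / (2 tmax), is at most 5/6. *)
apply: (@gronwall_sum _ _ _ a) => [|n _].
  by rewrite mulr_ge0// divr_ge0//; lra.
have hS : path_energy Z n.+1 <= 4 / 3 * (tau * (K - c + a n / (2 * tmax))).
  have := bdf2_dissipation n; have := hc _ (trajZ.1 n.+1).
  rewrite -/(a n) => h1.
  have := ler_wpM2l (ltW tau0) h1; have := inc_ge0 n; lra.
set M := K - c + _ in hS.
have M0 : 0 <= M.
  have := le_trans (path_energy_ge0 Z n.+1) hS.
  by rewrite pmulr_rge0 ?pmulr_rge0//; lra.
have h1 : (1 + tmax / (4 * tau)) * path_energy Z n.+1 <= 5 / 3 * tmax * M.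
  have h : (1 + tmax / (4 * tau)) * path_energy Z n.+1 <=
           (1 + tmax / (4 * tau)) * (4 / 3 * (tau * M)).
    by rewrite ler_wpM2l// addr_ge0// divr_ge0//; lra.
  apply: le_trans h _.
  rewrite (_ : _ * (4 / 3 * _) = 4 / 3 * (tau + tmax / 4) * M); last first.
    by field; lra.
  by rewrite ler_wpM2r//; lra.
have h2 := hinc n; rewrite /M in h1.
have E : 5 / 3 * tmax * (K - c + a n / (2 * tmax))
        = 5 / 3 * tmax * (K - c) + 5 / 6 * a n.
  by field; lra.
rewrite {}E in h1.
by rewrite -/(a 0%N); lra.
Qed.

(** The error theta_k of the perturbed implicit Euler inequality: a sum of
    theta0 and of the preceding squared increments with geometric weights. *)
Fixpoint memory (theta0 : R) (k : nat) : R :=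
  if k is k'.+1 then 1 / 3 * memory theta0 k' + 5 / 6 * inc k' else theta0.

Lemma memory_ge0 theta0 k : 0 <= theta0 -> 0 <= memory theta0 k.
Proof.
move=> t0; elim: k => [//|k IH] /=; have := inc_ge0 k; lra.
Qed.

(** Summed over time, the errors are controlled by the path energy. *)
Lemma sum_memory theta0 N :
  \sum_(k < N) memory theta0 k.+1 + 1 / 2 * memory theta0 N
    = 1 / 2 * theta0 + 5 / 4 * path_energy Z N.
Proof.
elim: N => [|N IH]; first by rewrite big_ord0 path_energy0 /=; lra.
rewrite big_ord_recr /= path_energyS -/(inc _); lra.
Qed.

(** BDF2 satisfies the implicit Euler inequality up to [memory], by induction:
    the increment of the squared distance at a step is 4/3 of the increment that
    [bdf2_evi] controls plus 1/3 of the preceding one, and E(Z k.+1) is replaced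
    by E(Z k.+2) at the cost of the dissipation inequality. *)
Lemma perturbed_euler theta0 w k : dom w ->
  mdist (Z 1) w ^+ 2 - mdist (Z 0) w ^+ 2
    <= 2 * tau * (e w - e (Z 1)) + theta0 ->
  mdist (Z k.+1) w ^+ 2 - mdist (Z k) w ^+ 2
    <= 2 * tau * (e w - e (Z k.+1)) + 2 * mu * tau * mdist (Z k.+1) w ^+ 2
       + memory theta0 k.
Proof.
move=> dw h0; have mt0 : 0 <= mu * tau by rewrite mulr_ge0// ltW.
elim: k => [|k IH] /=.
  have : 0 <= mu * tau * mdist (Z 1) w ^+ 2 by rewrite mulr_ge0// sqr_ge0.
  lra.
have h1 := bdf2_evi k w dw; have h2 := bdf2_dissipation_step k.
have h3 : mu * tau * mdist (Z k.+1) w ^+ 2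
    <= mu * tau * (2 * inc k.+1 + 2 * mdist (Z k.+2) w ^+ 2).
  by rewrite ler_wpM2l//; exact: sqr_mdist_triangle.
have h4 : mu * tau * inc k.+1 <= 1 / 2 * inc k.+1.
  by rewrite ler_wpM2r ?inc_ge0.
have t0 := tau0.
have h5 := inc_ge0 k.+1; lra.
Qed.

End trajectory.

Lemma sum_memory_le (R : realType) (X : metricType R) (Z : nat -> X)
    (theta0 : R) (r n : nat) : 0 <= theta0 ->
  \sum_(k < n) memory Z theta0 (r + k).+1
    <= 1 / 2 * theta0 + 5 / 4 * path_energy Z (r + n).
Proof.
move=> t0; rewrite -sum_memory big_split_ord /=.
have h1 : 0 <= \sum_(i < r) memory Z theta0 i.+1.
  by apply: sumr_ge0 => i _; exact: (memory_ge0 Z theta0 i.+1).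
have := memory_ge0 Z _ (r + n) t0.
lra.
Qed.

(** * Comparison of two discrete trajectories *)

Section comparison.
Context {R : realType} {X : metricType R}.
(** U has step tau and energies f, V has step eta = tau / m and energies g.
    Y is nondecreasing and bounds the energy drops of V; alpha and beta are the
    errors of U and V in the perturbed implicit Euler inequality. *)
Variables (U V : nat -> X) (f g Y alpha beta : nat -> R).
Variables (tau eta mu : R) (m N : nat).

(** One block: the m steps of V from index a are tested against U j.+1, and the
    step of U from j to j.+1 against V a. *)
Lemma comparison_step (j a : nat) :
  0 < eta -> 0 <= mu -> mu * tau <= 1 / 2 -> tau = m%:R * eta ->
  mdist (U j.+1) (V a) ^+ 2 - mdist (U j) (V a) ^+ 2
    <= 2 * tau * (g a - f j.+1) + 2 * mu * tau * mdist (U j.+1) (V a) ^+ 2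
       + alpha j ->
  (forall k, (a <= k < a + m)%N ->
     mdist (V k.+1) (U j.+1) ^+ 2 - mdist (V k) (U j.+1) ^+ 2
       <= 2 * eta * (f j.+1 - g k.+1)
          + 2 * mu * eta * mdist (V k.+1) (U j.+1) ^+ 2 + beta k) ->
  (forall k, (a <= k < a + m)%N -> Y k <= Y k.+1) ->
  (forall k, (a <= k < a + m)%N -> g k + Y k <= g k.+1 + Y k.+1) ->
  mdist (U j.+1) (V (a + m)%N) ^+ 2
    <= (1 + 12 * mu * tau) * mdist (U j) (V a) ^+ 2
       + (2 * tau * (Y (a + m)%N - Y a)
          + (\sum_(k < a + m) beta k - \sum_(k < a) beta k) + alpha j
          + 6 * mdist (U j) (U j.+1) ^+ 2
          + 2 * m%:R * (path_energy V (a + m) - path_energy V a)).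
Proof.
move=> eta0 mu0 mutau tauE hU hV hY hgY.
have Ymono l : (l <= m)%N -> Y a <= Y (a + l)%N.
  elim: l => [|l IH] lm; first by rewrite addn0.
  rewrite addnS (le_trans (IH (ltnW lm)))// hY//.
  by rewrite leq_addr/= ltn_add2l.
have Ymono' l : (l <= m)%N -> Y (a + (m - l))%N <= Y (a + m)%N.
  elim: l => [|l IH] lm; first by rewrite subn0.
  apply: le_trans (IH (ltnW lm)); rewrite -[(m - l)%N]prednK ?subn_gt0//.
  rewrite -subnS addnS hY// leq_addr/= ltn_add2l ltn_subrL /=.
  exact: leq_ltn_trans lm.
have gYmono l : (l <= m)%N -> g a + Y a <= g (a + l)%N + Y (a + l)%N.
  elim: l => [|l IH] lm; first by rewrite addn0.
  rewrite addnS (le_trans (IH (ltnW lm)))// hgY//.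
  by rewrite leq_addr/= ltn_add2l.
set P := mdist (U j) (V a) ^+ 2.
set D := mdist (U j) (U j.+1) ^+ 2.
set Q := path_energy V (a + m) - path_energy V a.
have Q0 : 0 <= Q by rewrite subr_ge0 le_path_energy// leq_addr.
have D0 : 0 <= D by exact: sqr_ge0.
have P0 : 0 <= P by exact: sqr_ge0.
have hP1 : mdist (U j.+1) (V a) ^+ 2 <= 2 * P + 2 * D.
  have := sqr_mdist_triangle (U j) (U j.+1) (V a).
  by rewrite (metric_sym (U j.+1) (U j)) -/P -/D; lra.
set M := 4 * P + 4 * D + 2 * m%:R * Q.
have hM l : (l <= m)%N -> mdist (V (a + l)%N) (U j.+1) ^+ 2 <= M.
  move=> lm; have := sqr_mdist_triangle (V a) (V (a + l)%N) (U j.+1).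
  rewrite (metric_sym (V (a + l)%N) (V a)) (metric_sym (V a) (U j.+1)).
  have h1 := sqr_mdist_path V a l.
  have h2 : l%:R * (path_energy V (a + l) - path_energy V a) <= m%:R * Q.
    rewrite ler_pM// ?ler_nat// ?subr_ge0 ?le_path_energy ?leq_addr//.
    by rewrite lerD2r le_path_energy// leq_add2l.
  by rewrite /M; lra.
have M0 : 0 <= M := le_trans (sqr_ge0 _) (hM 0%N (leq0n _)).
set dY := Y (a + m)%N - Y a.
have block l : (l <= m)%N -> mdist (V (a + l)%N) (U j.+1) ^+ 2
    <= mdist (V a) (U j.+1) ^+ 2 + l%:R * (2 * eta * (f j.+1 - g a + dY)
         + 2 * mu * eta * M)
       + (\sum_(k < a + l) beta k - \sum_(k < a) beta k).
  elim: l => [|l IH] lm; first by rewrite addn0 mul0r subrr !addr0.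
  have lt_lm : (a <= a + l < a + m)%N by rewrite leq_addr ltn_add2l.
  have h1 := IH (ltnW lm); have h2 := hV _ lt_lm.
  have h3 := gYmono _ lm; rewrite addnS in h3.
  have h4 := Ymono' (m - l.+1)%N (leq_subr _ _).
  rewrite subKn// addnS in h4.
  have h5 := hM _ lm; rewrite addnS in h5.
  rewrite addnS big_ord_recr /= -natr1.
  have h6 : 2 * eta * (f j.+1 - g (a + l).+1)
            <= 2 * eta * (f j.+1 - g a + dY).
    by rewrite ler_wpM2l ?/dY; lra.
  have h7 : 2 * mu * eta * mdist (V (a + l).+1) (U j.+1) ^+ 2
            <= 2 * mu * eta * M.
    by rewrite ler_wpM2l// ?mulr_ge0//; lra.
  lra.
have := block m (leqnn m); rewrite (metric_sym (V a)).
rewrite (metric_sym (V (a + m)%N)) => hB.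
have E1 : m%:R * (2 * eta * (f j.+1 - g a + dY) + 2 * mu * eta * M)
     = 2 * tau * (f j.+1 - g a + dY) + 2 * mu * tau * M.
  by rewrite tauE; ring.
rewrite {}E1 in hB.
have mt0 : 0 <= mu * tau by rewrite tauE !mulr_ge0// ltW.
have h1 : mu * tau * mdist (U j.+1) (V a) ^+ 2 <= mu * tau * (2 * P + 2 * D).
  by rewrite ler_wpM2l.
have h2 : mu * tau * D <= 1 / 2 * D by rewrite ler_wpM2r.
have h3 : mu * tau * (m%:R * Q) <= 1 / 2 * (m%:R * Q).
  by rewrite ler_wpM2r// mulr_ge0.
rewrite /M in hB; rewrite -/P in hU.
clearbody P D Q dY; lra.
Qed.

(** The blocks add up by Gronwall. *)
Lemma comparison :
  0 < eta -> 0 <= mu -> mu * tau <= 1 / 2 -> tau = m%:R * eta ->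
  (forall j k, (j < N)%N -> (k <= N * m)%N ->
     mdist (U j.+1) (V k) ^+ 2 - mdist (U j) (V k) ^+ 2
       <= 2 * tau * (g k - f j.+1) + 2 * mu * tau * mdist (U j.+1) (V k) ^+ 2
          + alpha j) ->
  (forall j k, (j <= N)%N -> (k < N * m)%N ->
     mdist (V k.+1) (U j) ^+ 2 - mdist (V k) (U j) ^+ 2
       <= 2 * eta * (f j - g k.+1) + 2 * mu * eta * mdist (V k.+1) (U j) ^+ 2
          + beta k) ->
  (forall k, (k < N * m)%N -> Y k <= Y k.+1) ->
  (forall k, (k < N * m)%N -> g k + Y k <= g k.+1 + Y k.+1) ->
  (forall j, 0 <= alpha j) -> (forall k, 0 <= beta k) ->
  mdist (U N) (V (N * m)%N) ^+ 2
    <= expR (12 * mu * (N%:R * tau))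
       * (mdist (U 0) (V 0) ^+ 2 + 2 * tau * (Y (N * m)%N - Y 0%N)
          + \sum_(k < N * m) beta k + \sum_(j < N) alpha j
          + 6 * path_energy U N + 2 * m%:R * path_energy V (N * m)).
Proof.
move=> eta0 mu0 mutau tauE hU hV hY hgY alpha0 beta0.
have mt0 : 0 <= mu * tau by rewrite tauE !mulr_ge0// ltW.
pose W j := 2 * tau * Y (j * m)%N + \sum_(k < j * m) beta k
  + \sum_(i < j) alpha i + 6 * path_energy U j
  + 2 * m%:R * path_energy V (j * m).
pose D j := mdist (U j) (V (j * m)%N) ^+ 2.
have inb j k : (j < N)%N -> (j * m <= k < j * m + m)%N -> (k < N * m)%N.
  move=> jN /andP[_ km]; apply: leq_trans km _.
  by rewrite -mulSnr leq_mul2r jN orbT.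
have hW j : (j < N)%N -> D j.+1 <= (1 + 12 * mu * tau) * D j + (W j.+1 - W j).
  move=> jN; rewrite /D /W !mulSnr.
  have := @comparison_step j (j * m)%N eta0 mu0 mutau tauE
    (hU j _ jN _) (fun k hk => hV _ _ jN (inb _ _ jN hk))
    (fun k hk => hY _ (inb _ _ jN hk)) (fun k hk => hgY _ (inb _ _ jN hk)).
  have -> : (j * m <= N * m)%N by rewrite leq_mul2r (ltnW jN) orbT.
  move=> /(_ isT) /le_trans; apply.
  rewrite big_ord_recr path_energyS /=; lra.
have mW j : (j < N)%N -> W j <= W j.+1.
  move=> jN; rewrite /W.
  have tau0 : 0 <= tau by rewrite tauE mulr_ge0// ltW.
  have h1 : Y (j * m)%N <= Y (j.+1 * m)%N.
    have h l : (l <= m)%N -> Y (j * m)%N <= Y (j * m + l)%N.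
      elim: l => [|l IH] lm; first by rewrite addn0.
      rewrite addnS (le_trans (IH (ltnW lm)))// hY// (inb j)//.
      by rewrite leq_addr ltn_add2l.
    by rewrite mulSnr h.
  have h2 : \sum_(k < j * m) beta k <= \sum_(k < j.+1 * m) beta k.
    rewrite mulSnr big_split_ord /= lerDl sumr_ge0// => i _; exact: beta0.
  have h3 : path_energy V (j * m) <= path_energy V (j.+1 * m).
    by rewrite le_path_energy// leq_mul2r leqnSn orbT.
  have h4 : path_energy U j <= path_energy U j.+1 by rewrite le_path_energy.
  rewrite big_ord_recr /=; have := alpha0 j.
  have := ler_wpM2l tau0 h1; have := ler_wpM2l (ler0n R m) h3; lra.
have b0 : 0 <= 12 * mu * tau by rewrite -mulrA mulr_ge0.
have := @gronwall_step _ _ D W N b0 mW hW.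
rewrite (_ : D 0%N + _ = mdist (U 0) (V 0) ^+ 2
    + 2 * tau * (Y (N * m)%N - Y 0%N)
    + \sum_(k < N * m) beta k + \sum_(j < N) alpha j
    + 6 * path_energy U N + 2 * m%:R * path_energy V (N * m)); last first.
  by rewrite /D /W mul0n !big_ord0 !path_energy0; ring.
move=> /le_trans; apply.
have W0N : 0 <= W N - W 0%N.
  rewrite subr_ge0; suff h n : (n <= N)%N -> W 0%N <= W n by exact: h.
  by elim: n => [//|n IH] hn; apply: le_trans (IH (ltnW hn)) (mW _ hn).
rewrite (_ : 12 * mu * (N%:R * tau) = 12 * mu * tau * N%:R); last by ring.
rewrite ler_wpM2r ?exprn_le_expR//.
apply: le_trans (_ : 0 <= mdist (U 0) (V 0) ^+ 2 + (W N - W 0%N)) _.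
  by rewrite addr_ge0// sqr_ge0.
by rewrite /W mul0n !big_ord0 !path_energy0; lra.
Qed.

End comparison.

(** * Minimizers of the BDF2 penalization *)

Section minimizer.
Context {R : realType} {X : completeMetricType R}.
Variables (E : X -> \bar R) (lambda tau_max tau : R) (u v : X).
Hypotheses (hE : forall w, (-oo < E w)%E).
Hypothesis hE3 : bdf2_convex E lambda tau_max.
Hypotheses (hlambda_tau : - lambda * tau_max <= 2^-1).
Hypotheses (tau_gt0 : 0 < tau) (tau_lt : tau < tau_max).
Hypotheses (du : domain E u) (dv : domain E v).

Let e w := fine (E w).
(** The penalization as a real function on the domain, and its modulus of
    convexity. *)
Let q w := mdist v w ^+ 2 / tau - mdist u w ^+ 2 / (4 * tau).
Let Phi w := q w + e w.
Let kappa := 2^-1 * (3 / (2 * tau) + lambda).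

Lemma domain_fine w : domain E w -> E w = (fine (E w))%:E.
Proof. by move=> dw; rewrite fineK// fin_numElt hE. Qed.

Lemma penalizationE w : domain E w ->
  bdf2_penalization E tau u v w = (Phi w)%:E.
Proof. by move=> dw; rewrite /bdf2_penalization (domain_fine _ dw) -EFinD. Qed.

(** From - lambda tau <= 1/2: in fact kappa tau >= 1/2. *)
Lemma kappa_gt0 : 0 < kappa.
Proof.
have t0 := tau_gt0; have t1 := tau_lt; have h := hlambda_tau.
have E1 : kappa * tau = 3 / 4 + lambda * tau / 2 by rewrite /kappa; field; lra.
suff : 0 < kappa * tau by rewrite pmulr_lgt0.
have : - (lambda * tau) <= 2^-1.
  have [l0|l0] := leP 0 lambda.
    have : 0 <= lambda * tau by rewrite mulr_ge0// ltW.
    lra.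
  apply: le_trans h; rewrite -mulNr ler_wpM2l ?ltW// oppr_gt0//.
lra.
Qed.

Lemma penalization_convex g0 g1 : domain E g0 -> domain E g1 ->
  forall s, 0 <= s <= 1 -> exists2 p, domain E p &
    Phi p <= (1 - s) * Phi g0 + s * Phi g1
             - kappa * s * (1 - s) * mdist g0 g1 ^+ 2.
Proof.
move=> d0 d1 s hs.
have [|g [_ _ _ /(_ s hs)]] := hE3 _ _ _ _ du dv d0 d1 tau.
  by rewrite tau_gt0.
rewrite (penalizationE _ d0) (penalizationE _ d1) -!EFinM -EFinD. move=> h.
have dg : domain E (g s).
  rewrite /domain /= ltNge leye_eq; apply/negP => /eqP Eg.
  by move: h; rewrite /bdf2_penalization Eg addey// leye_eq.
exists (g s) => //; move: h; rewrite penalizationE// lee_fin.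
Qed.

Lemma argmin_domain z : domain E !=set0 ->
  argmin (bdf2_penalization E tau u v) z -> domain E z.
Proof.
move=> [w dw] /(_ w); rewrite (penalizationE _ dw) => h.
rewrite /domain /= ltNge leye_eq; apply/negP => /eqP Ez.
by move: h; rewrite /bdf2_penalization Ez addey// leye_eq.
Qed.

(** Uniform convexity around a minimizer: divide the convexity inequality on the
    curve from z to w by s and let s tend to 0. *)
Lemma argmin_le z w : domain E z -> domain E w ->
  argmin (bdf2_penalization E tau u v) z ->
  Phi z + kappa * mdist z w ^+ 2 <= Phi w.
Proof.
move=> dz dw hz; rewrite leNgt; apply/negP => hlt.
pose del := Phi z + kappa * mdist z w ^+ 2 - Phi w.
pose a := kappa * mdist z w ^+ 2.
have a0 : 0 <= a by rewrite mulr_ge0 ?sqr_ge0// ltW// kappa_gt0.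
have del0 : 0 < del by rewrite subr_gt0.
have ad0 : 0 < 2 * (a + del) by lra.
(* so small that s a <= del / 2 *)
pose s := del / (2 * (a + del)).
have s0 : 0 < s by rewrite divr_gt0.
have s1 : s < 1 by rewrite ltr_pdivrMr//; lra.
have [|p dp] := penalization_convex _ _ dz dw s; first by rewrite !ltW.
have := hz p; rewrite (penalizationE _ dz) (penalizationE _ dp) lee_fin.
move=> h1 h2.
have h3 : s * (Phi z + (1 - s) * a - Phi w) <= 0 by rewrite /a; lra.
have h4 : Phi z + (1 - s) * a - Phi w <= 0 by rewrite pmulr_rle0 in h3.
have h5 : s * a <= del / 2.
  rewrite /s mulrAC ler_pdivrMr//.
  by have := mulr_ge0 (ltW del0) (ltW del0); lra.
have : Phi z + a - Phi w = del by [].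
lra.
Qed.

Lemma argmin_unique z z' : domain E !=set0 ->
  argmin (bdf2_penalization E tau u v) z ->
  argmin (bdf2_penalization E tau u v) z' -> z = z'.
Proof.
move=> d0 hz hz'.
have dz := argmin_domain _ d0 hz; have dz' := argmin_domain _ d0 hz'.
have h1 := argmin_le _ _ dz dz' hz; have h2 := argmin_le _ _ dz' dz hz'.
rewrite metric_sym in h2.
have h3 : kappa * mdist z z' ^+ 2 <= 0 by lra.
rewrite pmulr_rle0 ?kappa_gt0// in h3.
apply: mdist_positivity; apply/eqP; rewrite -sqrf_eq0.
by rewrite eq_le h3 sqr_ge0.
Qed.

End minimizer.

(** The coercivity constant as a real lower bound on the domain. *)
Lemma coercivity_real (R : realType) (X : completeMetricType R)
    (E : X -> \bar R) (tau : R) (x : X) :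
  (forall w, (-oo < E w)%E) -> (-oo < coercivity_constant E tau x)%E ->
  exists c : R, forall w, domain E w ->
    c <= mdist x w ^+ 2 / (2 * tau) + fine (E w).
Proof.
move=> hE; rewrite /coercivity_constant.
pose S := range (fun v => ((mdist x v ^+ 2 / (2 * tau))%:E + E v)%E).
rewrite -/S.
have hS w : (ereal_inf S <= (mdist x w ^+ 2 / (2 * tau))%:E + E w)%E.
  by apply: ereal_inf_lbound; exists w.
case: (ereal_inf S) hS => [r| |] hS // _.
  by exists r => w dw; have := hS w; rewrite (domain_fine _ hE _ dw) lee_fin.
exists 0 => w dw; have := hS w.
by rewrite (domain_fine _ hE _ dw) leye_eq.
Qed.

Section existence.
Context {R : realType} {X : completeMetricType R}.
Variables (E : X -> \bar R) (lambda tau_max tau : R) (u v x_ref : X).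
Hypotheses (hE : forall w, (-oo < E w)%E) (hdom : domain E !=set0).
Hypothesis hE1 : seq_lower_semicontinuous E.
Hypothesis hE2 : (-oo < coercivity_constant E tau_max x_ref)%E.
Hypothesis hE3 : bdf2_convex E lambda tau_max.
Hypotheses (hlambda_tau : - lambda * tau_max <= 2^-1).
Hypotheses (tau_gt0 : 0 < tau) (tau_lt : tau < tau_max).
Hypotheses (du : domain E u) (dv : domain E v).

Let q w := mdist v w ^+ 2 / tau - mdist u w ^+ 2 / (4 * tau).
Let Phi w := q w + fine (E w).
Let kappa := 2^-1 * (3 / (2 * tau) + lambda).

(** Young's inequality with weight 1/10, small enough for
    1 - (11/10) / 4 - (11/10) / 2 to be positive in [penalization_lbound]. *)
Lemma sqr_mdist_triangle_11 (x y z : X) :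
  mdist x z ^+ 2 <= 11 * mdist x y ^+ 2 + 11 / 10 * mdist y z ^+ 2.
Proof.
have := metric_triangle x y z; have := mdist_ge0 x z.
have := mdist_ge0 x y; have := mdist_ge0 y z.
have := sqr_ge0 (10 * mdist x y - mdist y z).
nra.
Qed.

Lemma penalization_lbound : exists b, forall w, domain E w -> b <= Phi w.
Proof.
have [c hc] := coercivity_real _ _ _ _ _ hE hE2.
exists (c - 11 * mdist u v ^+ 2 / (4 * tau)
          - 11 * mdist x_ref v ^+ 2 / (2 * tau_max)) => w dw.
have := hc w dw; rewrite /Phi /q.
have t0 := tau_gt0; have t1 := tau_lt; have T0 : 0 < tau_max by lra.
have i0 : 0 < tau^-1 by rewrite invr_gt0.
have i1 : 0 < tau_max^-1 by rewrite invr_gt0.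
have i2 : tau_max^-1 <= tau^-1 by rewrite lef_pV2// ?posrE// ltW.
rewrite !invfM.
have := ler_wpM2r (ltW i0) (sqr_mdist_triangle_11 u v w).
have := ler_wpM2r (ltW i1) (sqr_mdist_triangle_11 x_ref v w).
have := ler_wpM2l (sqr_ge0 (mdist v w)) i2.
have := mulr_ge0 (sqr_ge0 (mdist v w)) (ltW i1).
lra.
Qed.

Lemma argmin_exists : exists z, argmin (bdf2_penalization E tau u v) z.
Proof.
have t0 := tau_gt0.
pose S := Phi @` domain E.
have [b hb] := penalization_lbound.
have infS : has_inf S.
  split; first by case: hdom => w dw; exists (Phi w), w.
  by exists b => _ [w dw <-]; exact: hb.
have lbS w : domain E w -> inf S <= Phi w.
  by move=> dw; apply: (ge_inf infS.2); exists w.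
have /choice[ws hws] : forall n : nat, exists w, domain E w /\
    Phi w < inf S + n.+1%:R^-1.
  move=> n; have [|_ [w dw <-] hw] := @inf_adherent _ S (n.+1%:R^-1) _ infS.
    by rewrite invr_gt0.
  by exists w.
have kap0 := kappa_gt0 lambda _ _ hlambda_tau tau_gt0 tau_lt.
have hmin N n : (N <= n)%N -> Phi (ws n) <= inf S + N.+1%:R^-1.
  move=> Nn; apply: le_trans (ltW (hws n).2) _.
  by rewrite lerD2l lef_pV2 ?posrE ?ltr0n// ler_nat.
(* A minimizing sequence is Cauchy by convexity at the midpoint s = 1/2. *)
have [|z hz] := @cauchy_mdist_cvg _ _ ws.
  move=> eps eps0.
  have ke0 : 0 < kappa / 4 * eps ^+ 2 by rewrite mulr_gt0 ?exprn_gt0// divr_gt0.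
  have [N _ hN] : \forall n \near \oo, (n.+1%:R^-1 : R) < kappa / 4 * eps ^+ 2.
    exact: near_infty_natSinv_lt (PosNum ke0).
  exists N => n k Nn Nk.
  have [|p dp] := penalization_convex _ _ _ _ _ _ hE hE3 tau_gt0 tau_lt du dv
     _ _ (hws n).1 (hws k).1 (1 / 2).
    by apply/andP; split; lra.
  rewrite -/kappa -/(q _) -/(Phi _) -/(q _) -/(Phi _) -/(q _) -/(Phi _) => h1.
  have h2 := lbS p dp; have h3 := hmin _ _ Nn; have h4 := hmin _ _ Nk.
  have /= h5 := hN N (leqnn N).
  have h6 : kappa / 4 * mdist (ws n) (ws k) ^+ 2 < kappa / 4 * eps ^+ 2.
    clear -h1 h2 h3 h4 h5.
    move: h1 h2 h3 h4 h5.
    move: (Phi p) (Phi (ws n)) (Phi (ws k)) (N.+1%:R^-1) (inf S).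
    move=> x1 x2 x3 x4 x5.
    move: (mdist _ _) kappa => d k'; lra.
  rewrite ltr_pM2l in h6; last by rewrite divr_gt0.
  by rewrite ltr_pXn2r ?nnegrE ?mdist_ge0// ltW in h6.
have cq : q (ws n) @[n --> \oo] --> q z.
  rewrite /q; apply: cvgB; apply: cvgMr_tmp.
    by rewrite expr2; under eq_fun do rewrite expr2;
      apply: cvgM; apply: cvg_mdist => //; exact: cvg_cst.
  by rewrite expr2; under eq_fun do rewrite expr2;
      apply: cvgM; apply: cvg_mdist => //; exact: cvg_cst.
have hEz eps : 0 < eps -> (E z <= (inf S - q z + eps)%:E)%E.
  move=> eps0; apply: (seq_lsc_le _ _ _ _ hE1 hz).
  have e2 : 0 < eps / 2 by rewrite divr_gt0.
  have h1 : \forall n \near \oo, (n.+1%:R^-1 : R) < eps / 2.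
    exact: near_infty_natSinv_lt (PosNum e2).
  have /cvgrPdist_lt/(_ _ e2) h2 := cq.
  near=> n.
  have h3 : n.+1%:R^-1 < eps / 2 by near: n.
  have h4 : `|q z - q (ws n)| < eps / 2 by near: n.
  rewrite (domain_fine _ hE _ (hws n).1) lee_fin.
  have := (hws n).2; move: h4 h3; rewrite ltr_norml /Phi => /andP[].
  by move: (q z) (q _) (fine _) (inf S) (n.+1%:R^-1) => *; lra.
have dz : domain E z by rewrite /domain /= (le_lt_trans (hEz 1 _))// ltry.
exists z => w.
have [dw|dw] := boolP (E w < +oo)%E; last first.
  move: dw; rewrite -leNgt leye_eq => /eqP Ew.
  by rewrite {2}/bdf2_penalization Ew addey// leey.
rewrite !(penalizationE _ _ _ _ hE)// lee_fin.
rewrite -/(q _) -/(q _) -/(Phi _) -/(Phi _).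
apply: le_trans (lbS w dw); apply/ler_addgt0Pr => eps eps0.
by have := hEz _ eps0; rewrite (domain_fine _ hE _ dz) lee_fin /Phi; lra.
Unshelve. all: by end_near. Qed.

End existence.

(** * The time grid *)

(** The index of the step whose interval contains t: k for t in
    ](k - 1) tau, k tau].  For t > 0 it is the index used by
    [piecewise_constant]. *)
Definition grid_index {R : realType} (tau t : R) : nat :=
  absz (Num.ceil (t / tau)).

Section grid_index.
Context {R : realType}.
Implicit Types (tau t : R) (N : nat).

Lemma grid_indexE tau t : 0 < tau -> 0 <= t ->
  (grid_index tau t)%:R = (Num.ceil (t / tau))%:~R :> R.
Proof.
move=> tau0 t0; rewrite natr_absz ger0_norm// ceil_ge0.
by apply: lt_le_trans (divr_ge0 t0 (ltW tau0)); rewrite ltrN10.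
Qed.

Lemma grid_index_ge tau t : 0 < tau -> 0 <= t ->
  t <= (grid_index tau t)%:R * tau.
Proof.
by move=> tau0 t0; rewrite grid_indexE// -ler_pdivrMr// ceil_ge.
Qed.

Lemma grid_index_lt tau t : 0 < tau -> 0 <= t ->
  (grid_index tau t)%:R * tau < t + tau.
Proof.
move=> tau0 t0; rewrite grid_indexE// -ltr_pdivlMr// mulrDl divff ?gt_eqF//.
by have := ceilB1_lt (t / tau); rewrite intrB ltrBlDr.
Qed.

Lemma grid_index_le tau t N : 0 < tau -> 0 <= t -> t <= N%:R * tau ->
  (grid_index tau t <= N)%N.
Proof.
move=> tau0 t0 tN; rewrite -(ler_nat R) grid_indexE// -[N%:R]/((N : int)%:~R).
by rewrite ler_int ceil_le_int ler_pdivrMr.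
Qed.

Lemma grid_index_mono tau s t : 0 < tau -> 0 <= s -> s <= t ->
  (grid_index tau s <= grid_index tau t)%N.
Proof.
move=> tau0 s0 st; apply: grid_index_le => //; rewrite (le_trans st)//.
by apply: grid_index_ge => //; exact: le_trans st.
Qed.

End grid_index.

(** * Step functions, integrals and the Fatou lemma *)

(** Fatou's lemma on a measurable set of reals, with a convergent bound for the
    integrals. *)
Lemma fatou_le (R : realType) (D : set R) (f : R -> \bar R)
    (F : nat -> R -> \bar R) (b : nat -> R) (l : R) :
  measurable D -> measurable_fun D f -> (forall n, measurable_fun D (F n)) ->
  (forall r, D r -> (0 <= f r)%E) -> (forall n r, D r -> (0 <= F n r)%E) ->
  (forall r, D r -> (f r <= limn_einf (F^~ r))%E) ->
  (\forall n \near \oo,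
     (\int[lebesgue_measure]_(r in D) F n r <= (b n)%:E)%E) ->
  b n @[n --> \oo] --> l ->
  (\int[lebesgue_measure]_(r in D) f r <= l%:E)%E.
Proof.
move=> mD mf mF f0 F0 fF hb bl.
have h1 : (\int[lebesgue_measure]_(r in D) f r
    <= \int[lebesgue_measure]_(r in D) limn_einf (F^~ r))%E.
  apply: ge0_le_integral => //.
  apply: measurableT_comp => //; apply: measurable_fun_limn_esup => n.
  by apply: (measurableT_comp (f := oppe)) => //; exact: mF.
apply: le_trans h1 _.
have h2 := fatou lebesgue_measure mD mF F0.
apply: le_trans h2 _.
apply/lee_addgt0Pr => eps eps0.
apply: (@le_trans _ _ (limn_esup (fun n =>
  \int[lebesgue_measure]_(r in D) F n r)%E)); first exact: limn_einf_sup.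
rewrite limn_esup_lim; apply: lime_le; first exact: is_cvg_esups.
have n1 : \forall n \near \oo, b n <= l + eps.
  by apply: near_le_cvg bl _; rewrite ltrDl.
have : \forall n \near \oo,
    (\int[lebesgue_measure]_(r in D) F n r <= (l + eps)%:E)%E.
  by near=> n; apply: le_trans (_ : (b n)%:E <= _)%E;
    [near: n|rewrite lee_fin; near: n].
move=> [N _ hN]; exists N => // n /= Nn.
apply: ge_ereal_sup => _ [k /= nk <-]; rewrite -EFinD.
by apply: hN => /=; exact: leq_trans nk.
Unshelve. all: by end_near. Qed.

(** The function equal to phi i on ](J + i) tau, (J + i + 1) tau] for i < N, and
    to 0 elsewhere. *)
Definition step_fun {R : realType} (tau : R) (J N : nat) (phi : nat -> R)
    (r : R) : R :=
  \sum_(i < N) phi i * \1_(`](J + i)%:R * tau, (J + i).+1%:R * tau]%classic) r.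

Section step_fun.
Context {R : realType}.
Variables (tau : R) (J N : nat) (phi : nat -> R).

Lemma measurable_step_fun (D : set R) :
  measurable_fun D (step_fun tau J N phi).
Proof.
apply: measurable_sum => i; apply: measurable_funM; first exact: measurable_cst.
exact: measurable_indic.
Qed.

Hypothesis phi0 : forall i, (i < N)%N -> 0 <= phi i.

Lemma step_fun_ge0 r : 0 <= step_fun tau J N phi r.
Proof. by apply: sumr_ge0 => i _; rewrite mulr_ge0// phi0. Qed.

Lemma step_fun_ge i r : (i < N)%N ->
  (J + i)%:R * tau < r <= (J + i).+1%:R * tau ->
  phi i <= step_fun tau J N phi r.
Proof.
move=> iN hr; rewrite /step_fun (bigD1 (Ordinal iN))//= indicE.
rewrite mem_set ?mulr1; last by rewrite /= in_itv.
by rewrite lerDl sumr_ge0// => k _; rewrite mulr_ge0// phi0.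
Qed.

Lemma integral_step_fun (D : set R) : measurable D -> 0 < tau ->
  (\int[lebesgue_measure]_(r in D) (step_fun tau J N phi r)%:E
     <= (tau * \sum_(i < N) phi i)%:E)%E.
Proof.
move=> mD tau0; rewrite /step_fun.
under eq_integral do rewrite -sumEFin.
rewrite ge0_integral_sum//; last 2 first.
- move=> i; apply/measurable_EFinP; apply: measurable_funM.
    exact: measurable_cst.
  exact: measurable_indic.
- by move=> i r _; rewrite lee_fin mulr_ge0// phi0.
rewrite mulr_sumr -sumEFin; apply: lee_sum => i _.
under eq_integral do rewrite EFinM.
rewrite ge0_integralZl_EFin ?phi0//; last first.
  by apply/measurable_EFinP; exact: measurable_indic.
rewrite integral_indic// [tau * phi _]mulrC EFinM.
apply: lee_wpmul2l; first by rewrite lee_fin phi0.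
apply: (@le_trans _ _ (lebesgue_measure
  `](J + i)%:R * tau, (J + i).+1%:R * tau]%classic)).
  by apply: le_measure; rewrite ?inE//; exact: measurableI.
rewrite lebesgue_measure_itv /= lte_fin ltr_pM2r// ltr_nat ltnSn.
by rewrite -EFinB lee_fin -mulrBl -natrB// subSnn mul1r.
Qed.

End step_fun.

(** An upper bound on the integral of g >= 0 is a lower bound on that of
    M - g. *)
Lemma le_integral_cst_sub (R : realType) (s t M l : R) (g : R -> R) :
  s <= t -> measurable_fun (`]s, t[ : set R) g ->
  (forall r, s < r < t -> 0 <= g r) ->
  (\int[lebesgue_measure]_(r in `]s, t[) (g r)%:E <= l%:E)%E ->
  ((M * (t - s) - l)%:E
     <= \int[lebesgue_measure]_(r in `]s, t[) (M - g r)%:E)%E.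
Proof.
move=> st mg g0 gl.
have g0' r : (`]s, t[%classic : set R) r -> (0 <= (g r)%:E)%E.
  by rewrite /= in_itv /= => /g0; rewrite lee_fin.
have mu_st : lebesgue_measure (`]s, t[%classic : set R) = (t - s)%:E.
  rewrite lebesgue_measure_itv /= lte_fin; have [//|ts] := ltP s t.
  by rewrite (le_anti (introT andP (conj st ts))) subrr.
have ig : lebesgue_measure.-integrable `]s, t[%classic (EFin \o g).
  apply/integrableP; split; first exact/measurable_EFinP.
  apply: le_lt_trans (ltry l); apply: le_trans gl.
  rewrite le_eqVlt; apply/orP; left; apply/eqP; apply: eq_integral => r.
  by rewrite inE => /g0'; rewrite lee_fin => gr; rewrite /= ger0_norm.
have ic : lebesgue_measure.-integrable `]s, t[%classic
    (EFin \o (cst M : R -> R)).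
  apply/integrableP; split; first by apply/measurable_EFinP.
  under eq_integral do rewrite /=.
  rewrite integral_cst// [X in (_ * X)%E](_ : _ = (t - s)%:E) ?mu_st//.
  by rewrite -EFinM ltry.
under eq_integral do rewrite EFinB.
rewrite (integralB_EFin _ ic ig)//.
have -> : (\int[lebesgue_measure]_(r in `]s, t[) (cst M r)%:E
    = (M * (t - s))%:E)%E.
  under eq_integral do rewrite /=.
  by rewrite integral_cst// [X in (_ * X)%E](_ : _ = (t - s)%:E)
    ?mu_st// -EFinM.
by rewrite EFinB; exact: leeB.
Qed.

(** * Absolute continuity of contracting curves *)

Lemma le_cst_integral (R : realType) (m : R -> R) (k a b : R) :
  measurable_fun setT m -> (forall r, 0 <= m r) -> 0 <= k -> a <= b ->
  (forall r, a < r <= b -> k <= m r) ->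
  ((k * (b - a))%:E <= \int[lebesgue_measure]_(r in `]a, b]) (m r)%:E)%E.
Proof.
move=> mm m0 k0 ab km.
have mu_ab : lebesgue_measure (`]a, b]%classic : set R) = (b - a)%:E.
  rewrite lebesgue_measure_itv /= lte_fin; have [//|ba] := ltP a b.
  by rewrite (le_anti (introT andP (conj ab ba))) subrr.
have -> : ((k * (b - a))%:E = \int[lebesgue_measure]_(r in `]a, b]) k%:E)%E.
  by rewrite integral_cst// [X in (_ * X)%E](_ : _ = (b - a)%:E)
    ?mu_ab// -EFinM.
apply: ge0_le_integral => //.
by apply/measurable_EFinP; exact: measurable_funTS.
Qed.

Section ac2.
Context {R : realType} {X : metricType R}.
Variables (u : R -> X) (c : R).
Hypothesis c0 : 0 <= c.
Hypothesis u_cont : forall x eps, 0 < eps ->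
  \forall y \near x, mdist (u x) (u y) < eps.
Hypothesis u_contr : forall s r h, 0 <= s -> 0 <= r -> 0 <= h ->
  mdist (u (s + r)) (u (s + h + r)) ^+ 2
    <= expR (c * r) * mdist (u s) (u (s + h)) ^+ 2.
Hypothesis u_energy : forall T, exists2 B : R, 0 <= B & forall h (N : nat),
  0 <= h -> N%:R * h <= T ->
  \sum_(i < N) mdist (u (i%:R * h)) (u (i.+1%:R * h)) ^+ 2 <= B * h.

(** Length of the chord of u over [r, r + h], and dyadic step sizes. *)
Let chord r h := mdist (u r) (u (r + h)).
Let dyadic i : R := 2^-1 ^+ i.

Lemma dyadic_gt0 i : 0 < dyadic i.
Proof. by rewrite exprn_gt0// invr_gt0. Qed.

Lemma dyadic_le1 i : dyadic i <= 1.
Proof. by rewrite exprn_ile1// ?invr_ge0// invf_le1// ler1n. Qed.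

Lemma dyadicS i : dyadic i = 2 * dyadic i.+1.
Proof. by rewrite /dyadic exprS mulrA divff ?mul1r// pnatr_eq0. Qed.

Lemma cvg_dyadic : dyadic i @[i --> \oo] --> (0 : R).
Proof. by apply: cvg_expr; rewrite ger0_norm ?invr_ge0// invf_lt1// ltr1n. Qed.

Lemma chord_ge0 r h : 0 <= chord r h. Proof. exact: mdist_ge0. Qed.

Lemma chord_contr s r h : 0 <= s -> 0 <= r -> 0 <= h ->
  chord (s + r) h <= expR (c / 2 * r) * chord s h.
Proof.
move=> s0 r0 h0.
rewrite -(@ler_pXn2r _ 2) ?nnegrE ?mulr_ge0 ?expR_ge0 ?chord_ge0//.
rewrite exprMn -expRM_natr (_ : c / 2 * r * 2 = c * r); last by lra.
by have := u_contr s r h s0 r0 h0; rewrite /chord [s + r + h]addrAC.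
Qed.

(** Difference quotients with dyadic step, weighted so as to increase with i
    although u contracts only up to the factor exp (c / 2 r). *)
Let quot i r := expR (- (c / 2 * dyadic i)) * (chord r (dyadic i) / dyadic i).

Lemma quot_ge0 i r : 0 <= quot i r.
Proof.
by rewrite mulr_ge0 ?expR_ge0// divr_ge0 ?chord_ge0// ltW ?dyadic_gt0.
Qed.

(** The chord over [r, r + 2 h] is at most the sum of two chords of length h,
    and the second is at most exp (c / 2 h) times the first. *)
Lemma quotS i r : 0 <= r -> quot i r <= quot i.+1 r.
Proof.
move=> r0; rewrite /quot dyadicS.
set h := dyadic i.+1; have h0 : 0 < h by exact: dyadic_gt0.
have hD : chord r (2 * h) <= 2 * (expR (c / 2 * h) * chord r h).
  have h1 : chord r (2 * h) <= chord r h + chord (r + h) h.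
    have := metric_triangle (u r) (u (r + h)) (u (r + 2 * h)).
    by rewrite /chord (_ : r + 2 * h = r + h + h)//; ring.
  have h2 := chord_contr r h h r0 (ltW h0) (ltW h0).
  have h3 : 1 * chord r h <= expR (c / 2 * h) * chord r h.
    rewrite ler_wpM2r ?chord_ge0// -expR0 ler_expR mulr_ge0// ?divr_ge0//.
    exact: ltW.
  lra.
have hD' : chord r (2 * h) / (2 * h) <= expR (c / 2 * h) * (chord r h / h).
  rewrite ler_pdivrMr ?mulr_gt0//.
  rewrite (_ : _ * (2 * h) = 2 * (expR (c / 2 * h) * chord r h))//.
  by field; lra.
rewrite (_ : - (c / 2 * (2 * h)) = - (c / 2 * h) + - (c / 2 * h)); last by lra.
rewrite expRD -mulrA ler_pM2l ?expR_gt0//.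
by rewrite expRN mulrC ler_pdivrMr ?expR_gt0// [leRHS]mulrC.
Qed.

Lemma quot_nd r : 0 <= r -> nondecreasing_seq (fun i => quot i r).
Proof. by move=> r0; apply/nondecreasing_seqP => i; exact: quotS. Qed.

(** By contraction, the chord at r is controlled by all the chords between 0
    and r, whose squares have a sum of order h. *)
Lemma quot_bound r : 0 < r -> exists M, forall i, quot i r <= M.
Proof.
move=> r0; have [B B0 hB] := u_energy r.
have [i0 _ hi0] : \forall i \near \oo, dyadic i <= r.
  exact: near_le_cvg cvg_dyadic r0.
pose M := 2 * expR (c * r) * B / r.
have M0 : 0 <= M by rewrite divr_ge0 ?(ltW r0)// !mulr_ge0 ?expR_ge0.
suff H i : (i0 <= i)%N -> quot i r <= 1 + M.
  exists (1 + M) => i; apply: le_trans (H (maxn i0 i) (leq_maxl _ _)).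
  by apply: (quot_nd _ (ltW r0)); exact: leq_maxr.
move=> /hi0 /= hr; set h := dyadic i; have h0 : 0 < h by exact: dyadic_gt0.
pose N := Num.truncn (r / h).
have /andP[N1 N2] := truncn_itv (divr_ge0 (ltW r0) (ltW h0)).
rewrite -/N in N1 N2.
have N3 : N%:R * h <= r by rewrite -ler_pdivlMr.
have N_ge1 : 1 <= N%:R :> R.
  by rewrite ler1n truncn_gt0 ler_pdivlMr// mul1r.
have N4 : r <= 2 * (N%:R * h).
  have : r < (N%:R + 1) * h by rewrite natr1 -ltr_pdivrMr.
  have := ler_wpM2r (ltW h0) N_ge1; lra.
have hsum : N%:R * chord r h ^+ 2 <= expR (c * r) * (B * h).
  apply: le_trans (ler_wpM2l (expR_ge0 _) (hB h N (ltW h0) N3)).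
  rewrite mulr_sumr (_ : N%:R * _ = \sum_(j < N) chord r h ^+ 2); last first.
    by rewrite sumr_const card_ord mulr_natl.
  apply: ler_sum => j _.
  have jr : j%:R * h <= r.
    by apply: le_trans N3; rewrite ler_pM2r// ler_nat ltnW.
  have j0 : 0 <= j%:R * h by rewrite mulr_ge0// ltW.
  have := u_contr (j%:R * h) (r - j%:R * h) h j0 _ (ltW h0).
  rewrite subr_ge0 => /(_ jr).
  rewrite (_ : j%:R * h + (r - j%:R * h) = r); last by ring.
  rewrite (_ : j%:R * h + h + (r - j%:R * h) = r + h); last by ring.
  move=> /le_trans; apply.
  rewrite (_ : j%:R * h + h = j.+1%:R * h); last by rewrite -natr1; ring.
  apply: ler_wpM2r; first exact: sqr_ge0.
  by rewrite ler_expR ler_wpM2l// gerBl.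
have hq : (chord r h / h) ^+ 2 <= M.
  rewrite expr_div_n ler_pdivrMr ?exprn_gt0//.
  rewrite /M mulrAC ler_pdivlMr//.
  have := ler_wpM2l (sqr_ge0 (chord r h)) N4.
  have := ler_wpM2r (ltW h0) hsum.
  lra.
apply: (@le_trans _ _ (chord r h / h)).
  rewrite ler_piMl ?divr_ge0 ?chord_ge0 ?(ltW h0)// -expR0 ler_expR oppr_le0.
  by rewrite !mulr_ge0// ltW.
have := sqr_ge0 (chord r h / h - 1); lra.
Qed.

Lemma continuous_chord h : continuous (fun r => chord r h : R).
Proof.
move=> x; apply/cvgrPdist_lt => eps eps0.
have e2 : 0 < eps / 2 by rewrite divr_gt0.
have n1 := u_cont x _ e2.
have n2 : \forall y \near x, mdist (u (x + h)) (u (y + h)) < eps / 2.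
  have cx : (fun y => y + h) y @[y --> x] --> x + h.
    by apply: cvgD; [exact: cvg_id|exact: cvg_cst].
  exact: cx _ (u_cont (x + h) _ e2).
near=> y; apply: le_lt_trans (ler_dist_mdist _ _ _ _) _.
rewrite [ltRHS](splitr eps) ltrD//; first by near: y.
by near: y.
Unshelve. all: by end_near. Qed.

(** The quotients extended by 0 to r <= 0; at r = 0 they may be unbounded. *)
Let near_speed i r := quot i r * \1_(`]0, +oo[%classic) r.

Lemma near_speed_pos i r : 0 < r -> near_speed i r = quot i r.
Proof.
by move=> r0; rewrite /near_speed indicE mem_set ?mulr1//= in_itv /= r0.
Qed.

Lemma near_speed_npos i r : r <= 0 -> near_speed i r = 0.
Proof.
move=> r0; rewrite /near_speed indicE memNset ?mulr0//= in_itv /= andbT.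
by apply/negP; rewrite -leNgt.
Qed.

Lemma near_speed_ge0 i r : 0 <= near_speed i r.
Proof. by rewrite /near_speed mulr_ge0// quot_ge0. Qed.

Lemma measurable_near_speed i : measurable_fun setT (near_speed i).
Proof.
apply: measurable_funM; last exact: measurable_indic.
apply: measurable_funM; first exact: measurable_cst.
apply: measurable_funM; last exact: measurable_cst.
exact: continuous_measurable_fun (continuous_chord _).
Qed.

(** A speed of u: the increasing limit of the weighted quotients. *)
Let speed r := limn (fun i => near_speed i r).

Lemma cvg_near_speed r : near_speed i r @[i --> \oo] --> speed r.
Proof.
suff : cvgn (fun i => near_speed i r) by [].
have [r0|r0] := leP r 0.
  rewrite (_ : (fun i => near_speed i r) = fun=> 0); first exact: is_cvg_cst.
  by apply/funext => i; exact: near_speed_npos.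
rewrite (_ : (fun i => near_speed i r) = fun i => quot i r).
  apply: nondecreasing_is_cvgn; first exact: quot_nd (ltW r0).
  by have [M hM] := quot_bound _ r0; exists M => _ [i _ <-].
by apply/funext => i; exact: near_speed_pos.
Qed.

Lemma near_speed_le i r : near_speed i r <= speed r.
Proof.
apply: nondecreasing_cvgn_le; last exact: cvg_near_speed.
have [r0|r0] := leP r 0; first by move=> j k jk; rewrite !near_speed_npos.
by move=> j k jk; rewrite !near_speed_pos//; apply: quot_nd => //; exact: ltW.
Qed.

Lemma speed_ge0 r : 0 <= speed r.
Proof. exact: le_trans (near_speed_ge0 0 r) (near_speed_le 0 r). Qed.

Lemma measurable_speed : measurable_fun setT speed.
Proof.
apply: measurable_fun_cvg measurable_near_speed _ => r _.
exact: cvg_near_speed.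
Qed.

(** On each cell of the dyadic grid the weighted quotient is at most the plain
    quotient at the left end, so the integral of its square is bounded by
    [u_energy]. *)
Lemma speed_L2_loc : L2_loc speed.
Proof.
split; first exact: measurable_funTS measurable_speed.
move=> T T0; have [B B0 hB] := u_energy (T + 1).
apply: (@le_lt_trans _ _ B%:E); last exact: ltry.
have mD : measurable (`[0, T]%classic : set R) by exact: measurable_itv.
have m2 (g : R -> R) : measurable_fun setT g ->
    measurable_fun (`[0, T] : set R) (fun r => ((g r) ^+ 2)%:E).
  move=> mg; apply/measurable_EFinP; apply: measurable_funTS.
  by under eq_fun do rewrite expr2; exact: measurable_funM.
apply: (fatou_le _ _ (fun r => ((speed r) ^+ 2)%:E)
  (fun i r => ((near_speed i r) ^+ 2)%:E)
  (fun=> B) B mD).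
- exact: m2 measurable_speed.
- by move=> i; exact: m2 (measurable_near_speed i).
- by move=> r _; rewrite lee_fin sqr_ge0.
- by move=> i r _; rewrite lee_fin sqr_ge0.
- move=> r _; apply/lee_subgt0Pr => eps eps0; apply: limn_einf_ge.
  have /cvgrPdist_lt/(_ _ eps0) := cvg_sqr _ _ _ (cvg_near_speed r).
  apply: filterS => i; rewrite ltr_norml => /andP[_].
  by rewrite -EFinB lee_fin; lra.
- apply: nearW => i /=.
  set h := dyadic i; have h0 : 0 < h := dyadic_gt0 i.
  pose N := grid_index h T.
  have N1 : T <= N%:R * h by exact: grid_index_ge (ltW T0).
  have N2 : N%:R * h <= T + 1.
    have := grid_index_lt h T h0 (ltW T0); have := dyadic_le1 i.
    by rewrite -/h -/N; lra.
  (* phi j bounds the squared quotient on ]j h, (j + 1) h] *)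
  pose phi j := (chord (j%:R * h) h / h) ^+ 2.
  have phi0 j : (j < N)%N -> 0 <= phi j by rewrite sqr_ge0.
  have le_step : (
      \int[lebesgue_measure]_(r in `[0%R, T]) ((near_speed i r) ^+ 2)%:E
      <= \int[lebesgue_measure]_(r in `[0%R, T]) (step_fun h 0 N phi r)%:E)%E.
    apply: ge0_le_integral => //.
    + by move=> r _; rewrite lee_fin sqr_ge0.
    + exact: m2 (measurable_near_speed i).
    + by apply/measurable_EFinP; exact: measurable_step_fun.
    move=> r /=; rewrite in_itv /= => /andP[r0 rT]; rewrite lee_fin.
    have [r_le0|r_gt0] := leP r 0.
      by rewrite near_speed_npos// expr0n /= step_fun_ge0.
    have k1 := grid_index_ge h r h0 r0; have k2 := grid_index_lt h r h0 r0.
    have kN : (grid_index h r <= N)%N by exact: grid_index_mono.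
    case: (grid_index h r) k1 k2 kN => [|j] k1 k2 jN.
      by move: k1; rewrite mul0r leNgt r_gt0.
    have jr : (0 + j)%:R * h < r <= (0 + j).+1%:R * h.
      by rewrite add0n k1 andbT; move: k2; rewrite -natr1; lra.
    apply: le_trans (step_fun_ge h 0 N phi phi0 j r jN jr).
    rewrite near_speed_pos// /phi ler_pXn2r ?nnegrE ?quot_ge0//; last first.
      by rewrite divr_ge0 ?chord_ge0// ltW.
    rewrite /quot -/h mulrA ler_pM2r ?invr_gt0//.
    move: jr; rewrite !add0n -natr1 => /andP[jr1 jr2].
    have j0 : 0 <= j%:R * h by rewrite mulr_ge0// ltW.
    have rj0 : 0 <= r - j%:R * h by lra.
    have := chord_contr (j%:R * h) (r - j%:R * h) h j0 rj0 (ltW h0).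
    rewrite (_ : j%:R * h + (r - j%:R * h) = r); last by ring.
    move=> h1; rewrite expRN mulrC ler_pdivrMr ?expR_gt0//.
    rewrite [leRHS]mulrC; apply: le_trans h1 _.
    apply: ler_wpM2r; first exact: chord_ge0.
    by rewrite ler_expR ler_wpM2l ?divr_ge0//; lra.
  apply: le_trans le_step _.
  apply: le_trans (integral_step_fun h 0 N phi phi0 _ mD h0) _.
  rewrite lee_fin /phi.
  under eq_bigr do rewrite expr_div_n.
  rewrite -mulr_suml mulrA ler_pdivrMr ?exprn_gt0// expr2 mulrA [leLHS]mulrC.
  rewrite ler_pM2r//; apply: le_trans (hB h N (ltW h0) N2).
  by apply: ler_sum => j _; rewrite /chord -natr1 mulrDl mul1r.
- exact: cvg_cst.
Qed.

(** Each chord is at most a multiple of the speed on the cell to its left, so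
    that the first cell carries no chord. *)
Lemma chain_le_integral s i k : 0 <= s ->
  ((expR (- (c * dyadic i))
    * mdist (u (s + dyadic i)) (u (s + k.+1%:R * dyadic i)))%:E
     <= \int[lebesgue_measure]_(r in `]s, (s + k%:R * dyadic i)%R])
          (speed r)%:E)%E.
Proof.
move=> s0; set h := dyadic i; have h0 : 0 < h := dyadic_gt0 i.
elim: k => [|k IH].
  rewrite mul1r mdistxx mulr0.
  by apply: integral_ge0 => r _; rewrite lee_fin speed_ge0.
set a := s + k%:R * h; set b := s + k.+1%:R * h.
have bE : b = a + h by rewrite /b /a -natr1; ring.
have sa : s <= a by rewrite lerDl mulr_ge0// ltW.
have ab : a <= b by rewrite bE lerDl ltW.
have mm A : measurable_fun A (fun r => (speed r)%:E).
  by apply/measurable_EFinP; exact: measurable_funTS measurable_speed.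
rewrite (@itv_bndbnd_setU _ _ _ (BRight a)) ?bnd_simp//.
rewrite ge0_integral_setU//; last 3 first.
- exact: mm.
- by move=> r _; rewrite lee_fin speed_ge0.
- apply/disj_setPS => r /=; rewrite !in_itv /= => -[/andP[_ ra] /andP[ar _]].
  by move: ar; rewrite ltNge ra.
have hk : forall r, a < r <= b -> expR (- (c * h)) * (chord b h / h) <= speed r.
  move=> r /andP[ar rb]; have r0 : 0 < r by apply: le_lt_trans ar; lra.
  apply: le_trans (near_speed_le i r); rewrite near_speed_pos// /quot -/h.
  rewrite mulrA mulrA ler_pM2r ?invr_gt0//.
  have br0 : 0 <= b - r by lra.
  have := chord_contr r (b - r) h (ltW r0) br0 (ltW h0).
  rewrite (_ : r + (b - r) = b); last by ring.
  move=> h1; rewrite (_ : - (c * h) = - (c / 2 * h) + - (c / 2 * h)); last by lra.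
  rewrite expRD -mulrA ler_pM2l ?expR_gt0//.
  rewrite expRN mulrC ler_pdivrMr ?expR_gt0// [leRHS]mulrC.
  apply: le_trans h1 _; apply: ler_wpM2r; first exact: chord_ge0.
  by rewrite ler_expR ler_wpM2l ?divr_ge0//; lra.
have kap0 : 0 <= expR (- (c * h)) * (chord b h / h).
  by rewrite mulr_ge0 ?expR_ge0// divr_ge0 ?chord_ge0// ltW.
have := le_cst_integral _ _ _ _ _ measurable_speed speed_ge0 kap0 ab hk.
move=> h2; apply: le_trans (leeD IH h2); rewrite -EFinD lee_fin.
rewrite (_ : b - a = h); last by rewrite bE; ring.
rewrite -mulrA divfK ?gt_eqF// -mulrDr ler_pM2l ?expR_gt0//.
rewrite /chord (_ : s + k.+2%:R * h = b + h).
  exact: metric_triangle.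
by rewrite /b -(natr1 k.+1); ring.
Qed.

(** A continuous curve whose chords contract along time, up to an exponential
    factor, and whose quadratic variation along grids of step h is O(h), belongs
    to AC2. *)
Lemma AC2_of_contraction : AC2 u.
Proof.
exists speed; first exact: speed_L2_loc.
move=> s t s0; rewrite le_eqVlt => /predU1P[<-|st].
  by rewrite mdistxx; apply: integral_ge0 => r _; rewrite lee_fin speed_ge0.
set I := (\int[lebesgue_measure]_(r in `[s, t]) (speed r)%:E)%E.
have I0 : (0 <= I)%E by apply: integral_ge0 => r _; rewrite lee_fin speed_ge0.
pose N i := Num.truncn ((t - s) / dyadic i).
have hN i : (N i)%:R * dyadic i <= t - s < ((N i)%:R + 1) * dyadic i.
  have ts : 0 <= (t - s) / dyadic i.
    by rewrite divr_ge0 ?subr_ge0 ?(ltW st)// ltW// dyadic_gt0.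
  have /andP[h1 h2] := truncn_itv ts.
  rewrite -ler_pdivlMr ?dyadic_gt0// -ltr_pdivrMr ?dyadic_gt0//.
  by rewrite natr1 h1 h2.
have hI i : (0 < N i)%N ->
    ((expR (- (c * dyadic i))
      * mdist (u (s + dyadic i)) (u (s + (N i)%:R * dyadic i)))%:E <= I)%E.
  move=> Ni; have := chain_le_integral s i (N i).-1 s0.
  rewrite prednK// => /le_trans; apply.
  apply: ge0_subset_integral => //.
  - by apply/measurable_EFinP; exact: measurable_funTS measurable_speed.
  - by move=> r _; rewrite lee_fin speed_ge0.
  move=> r /=; rewrite !in_itv /= => /andP[sr rN].
  rewrite (ltW sr) /=; apply: le_trans rN _.
  have /andP[h1 _] := hN i; have := dyadic_gt0 i.
  have : (N i).-1%:R + 1 = (N i)%:R :> R by rewrite natr1 prednK.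
  by move=> hE h0; move: h1; rewrite -hE; lra.
case: I I0 hI => [I| |] // I0 hI; last by rewrite leey.
rewrite lee_fin metric_sym.
have cs : s + dyadic i @[i --> \oo] --> s.
  rewrite -[X in _ --> X]addr0; apply: cvgD; first exact: cvg_cst.
  exact: cvg_dyadic.
have ct : s + (N i)%:R * dyadic i @[i --> \oo] --> t.
  apply: (@squeeze_cvgr _ _ _ _ (fun i => t - dyadic i) (fun=> t)).
  - by apply: nearW => i; have /andP[h1 h2] := hN i; apply/andP; split; lra.
  - rewrite -[X in _ --> X]subr0; apply: cvgB; first exact: cvg_cst.
    exact: cvg_dyadic.
  - exact: cvg_cst.
have cu (y_ : nat -> R) y : y_ i @[i --> \oo] --> y ->
    u (y_ i) @[i --> \oo] --> u y.
  move=> yy; apply/metricType_numDomainType.cvgrPdist_lt => eps eps0.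
  exact: yy _ (u_cont y _ eps0).
apply: (@ler_cvgn _ (fun i => expR (- (c * dyadic i))
  * mdist (u (s + dyadic i)) (u (s + (N i)%:R * dyadic i))) (fun=> I)).
- rewrite -[X in _ --> X]mul1r; apply: cvgM.
    rewrite -expR0 -oppr0 -(mulr0 c).
    apply: continuous_cvg; first exact: continuous_expR.
    by apply: cvgN; apply: cvgMl_tmp; exact: cvg_dyadic.
  by apply: cvg_mdist; exact: cu.
- exact: cvg_cst.
- have ts : 0 < t - s by rewrite subr_gt0.
  near=> i; rewrite -lee_fin; apply: hI.
  have /andP[_ h2] := hN i.
  have h3 : dyadic i <= t - s by near: i; exact: near_le_cvg cvg_dyadic ts.
  by rewrite truncn_gt0 ler_pdivlMr ?dyadic_gt0// mul1r.
Unshelve. all: by end_near. Qed.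

End ac2.

(** * Discrete solutions *)

(** The iterates with both initial data, shifted by one: index 0 is the datum of
    index -1. *)
Definition history {X : Type} (um1 : X) (U : nat -> X) (k : nat) : X :=
  if k is j.+1 then U j else um1.

Section discrete.
Context {R : realType} {X : completeMetricType R}.
Variables (E : X -> \bar R) (lambda tau_max : R) (x_ref u0 : X).
Hypotheses (hE : forall w, (-oo < E w)%E) (hdom : domain E !=set0).
Hypothesis hE1 : seq_lower_semicontinuous E.
Hypothesis hE2 : (-oo < coercivity_constant E tau_max x_ref)%E.
Hypothesis hE3 : bdf2_convex E lambda tau_max.
Hypothesis htau_max : 0 < tau_max.
Hypotheses (hlambda : lambda <= 0) (hlambda_tau : - lambda * tau_max <= 2^-1).

Let e w := fine (E w).

Lemma discrete_solution_exists tau um1 v0 :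
  0 < tau < tau_max -> domain E um1 -> domain E v0 ->
  exists! U : nat -> X, discrete_solution E tau um1 v0 U.
Proof.
move=> /andP[tau0 taum] d1 d0.
have /choice[next hnext] : forall p : X * X, exists z,
    domain E p.1 -> domain E p.2 ->
    argmin (bdf2_penalization E tau p.1 p.2) z.
  move=> [u v] /=; have [du|ndu] := pselect (domain E u); last first.
    by exists u => /ndu.
  have [dv|ndv] := pselect (domain E v); last by exists u => _ /ndv.
  have [z hz] := argmin_exists E lambda tau_max tau u v x_ref
    hE hdom hE1 hE2 hE3 hlambda_tau tau0 taum du dv.
  by exists z.
pose P k := iter k (fun p : X * X => (p.2, next p)) (um1, v0).
have dP k : domain E (P k).1 /\ domain E (P k).2.
  elim: k => [//|k [h1 h2]]; split => //=.
  by apply: (argmin_domain _ _ _ _ hE _ hdom (hnext _ h1 h2)).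
have uniq u v z z' : domain E u -> domain E v ->
    argmin (bdf2_penalization E tau u v) z ->
    argmin (bdf2_penalization E tau u v) z' -> z = z'.
  move=> du dv; exact: (argmin_unique _ _ _ _ _ _ hE hE3 hlambda_tau tau0 taum
    du dv _ _ hdom).
exists (fun k => (P k).2); split.
  split => // k; rewrite [X in bdf2_penalization E tau X](_ : _ = (P k).1).
    by have [h1 h2] := dP k; exact: hnext.
  by case: k.
move=> U [U0 hU].
have UP k : (P k).1 = history um1 U k /\ (P k).2 = U k.
  elim: k => [//|k [h1 h2]]; split => //=.
  have [h3 h4] := dP k.
  apply: (uniq (P k).1 (P k).2) => //; first exact: hnext.
  by rewrite h1 h2; exact: hU.
by apply/funext => k; have [] := UP k.
Qed.

Lemma discrete_trajectory tau um1 v0 U :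
  0 < tau < tau_max -> domain E um1 -> domain E v0 ->
  discrete_solution E tau um1 v0 U ->
  bdf2_trajectory (domain E) e tau (- lambda) (history um1 U).
Proof.
move=> /andP[tau0 taum] d1 d0 [U0 hU].
have dZ k : domain E (history um1 U k) /\ domain E (history um1 U k.+1).
  elim: k => [|k [h1 h2]]; first by rewrite /= U0.
  split => //; exact: (argmin_domain _ _ _ _ hE _ hdom (hU k)).
split => [k|k w dw]; first by have [] := dZ k.
have [h1 h2] := dZ k; have [_ h3] := dZ k.+1.
have := argmin_le _ _ _ _ _ _ hE hE3 hlambda_tau tau0 taum h1 h2 _ _ h3 dw
  (hU k).
set z := history um1 U k.+2; set u := history um1 U k.
set v := history um1 U k.+1; rewrite -/(e z) -/(e w).
rewrite -(ler_pM2l tau0).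
set a := mdist v z ^+ 2; set b := mdist u z ^+ 2; set c := mdist z w ^+ 2.
set a' := mdist v w ^+ 2; set b' := mdist u w ^+ 2.
have -> : tau * (a / tau - b / (4 * tau) + e z
     + 2^-1 * (3 / (2 * tau) + lambda) * c) =
  a - b / 4 + tau * e z + 3 / 4 * c + tau * lambda / 2 * c.
  by field; lra.
have -> : tau * (a' / tau - b' / (4 * tau) + e w) = a' - b' / 4 + tau * e w.
  by field; lra.
lra.
Qed.

(** The hypotheses on the step and on the initial data, with their constants. *)
Definition admissible (K0 K1 K2 tau : R) (um1 v0 : X) : Prop :=
  [/\ 0 < tau < tau_max, mdist v0 u0 <= K0 * tau,
      (E v0 <= K1%:E)%E /\ (E um1 <= K1%:E)%E & mdist um1 v0 <= K2 * tau].

Lemma admissible_domain K0 K1 K2 tau um1 v0 :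
  admissible K0 K1 K2 tau um1 v0 -> domain E um1 /\ domain E v0.
Proof.
by move=> [_ _ [h0 h1] _]; split; [move: h1|move: h0] => /le_lt_trans;
  apply; exact: ltry.
Qed.

Let mu_tau tau : 0 < tau < tau_max -> (- lambda) * tau <= 1 / 2.
Proof.
move=> /andP[t0 tm]; rewrite div1r; apply: le_trans hlambda_tau.
by rewrite ler_wpM2l ?oppr_ge0// ltW.
Qed.

(** Bounds on a time interval [0, T], uniform in the step and in the data. *)
Lemma discrete_bound K0 K1 K2 T : exists2 B : R, 0 <= B &
  forall tau um1 v0 U, admissible K0 K1 K2 tau um1 v0 ->
  discrete_solution E tau um1 v0 U ->
  forall k, k%:R * tau <= T ->
  [/\ mdist x_ref (U k) ^+ 2 <= B, - B <= e (U k) <= B &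
      path_energy (history um1 U) k.+1 <= B * tau].
Proof.
have [c hc] := coercivity_real _ _ _ _ _ hE hE2.
pose K := K1 + K2 ^+ 2 * tau_max.
pose a0 := 2 * mdist x_ref u0 ^+ 2 + 2 * (K0 * tau_max) ^+ 2.
pose A := (6 * a0 + 10 * tau_max * `|K - c|) * expR (24 * (T / tau_max)).
pose L := `|c| + A / (2 * tau_max) + `|K|.
have a0_ge0 : 0 <= a0 by rewrite /a0 addr_ge0// mulr_ge0// sqr_ge0.
have A0 : 0 <= A.
  rewrite /A mulr_ge0 ?expR_ge0// addr_ge0 ?mulr_ge0//.
  exact: ltW.
have A1 : 0 <= A / (2 * tau_max) by rewrite divr_ge0// mulr_ge0// ltW.
have L0 : 0 <= L by rewrite /L !addr_ge0.
exists (A + L + 4 / 3 * (`|K| + L)).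
  by rewrite !addr_ge0// mulr_ge0// addr_ge0.
move=> tau um1 v0 U adm dU k kT.
have [/andP[tau0 taum] h0 [hE0 hEm1] hd] := adm.
have [d1 d0] := admissible_domain _ _ _ _ _ _ adm.
have tm0 := htau_max.
have hmt : - lambda * tau <= 1 / 2 by apply: mu_tau; rewrite tau0.
have m0 : 0 <= - lambda by rewrite oppr_ge0.
have tr := discrete_trajectory tau um1 v0 U _ d1 d0 dU.
rewrite tau0 taum in tr; have {}tr := tr isT.
have [U0 _] := dU.
have hinc : mdist um1 v0 ^+ 2 <= (K2 * tau) ^+ 2.
  by rewrite lerXn2r ?nnegrE ?mdist_ge0// (le_trans (mdist_ge0 _ _) hd).
have hK : tau * e v0 + mdist um1 v0 ^+ 2 <= tau * K.
  have h1 : tau * e v0 <= tau * K1.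
    by rewrite ler_pM2l// -lee_fin -(domain_fine _ hE _ d0).
  have h2 : K2 ^+ 2 * tau * tau <= K2 ^+ 2 * tau * tau_max.
    apply: ler_wpM2l; last exact: ltW.
    by apply: mulr_ge0; [exact: sqr_ge0|exact: ltW].
  by rewrite /K; lra.
have ha0 : mdist x_ref v0 ^+ 2 <= a0.
  have := sqr_mdist_triangle u0 x_ref v0; rewrite (metric_sym u0).
  have : mdist v0 u0 ^+ 2 <= (K0 * tau) ^+ 2.
    by rewrite lerXn2r ?nnegrE ?mdist_ge0// (le_trans (mdist_ge0 _ _) h0).
  have : (K0 * tau) ^+ 2 <= (K0 * tau_max) ^+ 2.
    rewrite !exprMn ler_wpM2l ?sqr_ge0//.
    by apply: lerXn2r; rewrite ?nnegrE ltW.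
  by rewrite /a0; lra.
have hA : mdist x_ref (U k) ^+ 2 <= A.
  have := bdf2_bound _ _ _ _ _ tau0 hmt tr tau_max c K x_ref k taum hc.
  rewrite /= U0 => /(_ hK) /le_trans; apply; rewrite /A.
  have nn : 0 <= (1 + 24 * (tau / tau_max)) ^+ k.
    by rewrite exprn_ge0// addr_ge0// mulr_ge0// divr_ge0 ?ltW.
  apply: ler_pM => //; last first.
  - apply: le_trans (exprn_le_expR _ _ _ _) _.
      by rewrite mulr_ge0// divr_ge0 ?ltW.
    rewrite ler_expR -mulrA ler_pM2l// mulrAC ler_pM2r ?invr_gt0//.
    by rewrite mulrC.
  - apply: lerD; first by rewrite ler_pM2l//; lra.
    by rewrite ler_pM2l ?ler_norm// mulr_gt0.
  - have := hc _ d0; have e0K : e v0 <= K.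
      by rewrite -(ler_pM2l tau0); have := sqr_ge0 (mdist um1 v0); lra.
    set q := mdist x_ref v0 ^+ 2 => hcv.
    have : 0 <= 10 * tau_max * (q / (2 * tau_max) + K - c).
      apply: mulr_ge0; first by apply: mulr_ge0 => //; exact: ltW.
      by rewrite /e in e0K; lra.
    have -> : 10 * tau_max * (q / (2 * tau_max) + K - c)
            = 5 * q + 10 * tau_max * (K - c) by field; lra.
    have := sqr_ge0 (mdist x_ref v0); rewrite -/q; lra.
have hK' := bdf2_dissipation _ _ _ _ _ hmt tr k.
have hc' := hc _ (tr.1 k.+1).
rewrite /= U0 in hK' hc'.
have p0 := path_energy_ge0 (history um1 U) k.+1.
have i0 : 0 <= mdist (history um1 U k) (U k) ^+ 2 by exact: sqr_ge0.
have Kn := ler_norm K; have cn := ler_norm (- c); rewrite normrN in cn.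
have K0n := normr_ge0 K; have c0n := normr_ge0 c.
have hL : - L <= e (U k).
  have : mdist x_ref (U k) ^+ 2 / (2 * tau_max) <= A / (2 * tau_max).
    by rewrite ler_pM2r// invr_gt0 mulr_gt0.
  by rewrite /L /e; lra.
have hU : e (U k) <= K.
  by rewrite -(ler_pM2l tau0); lra.
split.
- lra.
- by apply/andP; split; rewrite /L in L0 hL *; lra.
- have : - L * tau <= e (U k) * tau by rewrite ler_pM2r.
  have : K * tau <= `|K| * tau by rewrite ler_pM2r.
  have := mulr_ge0 A0 (ltW tau0); have := mulr_ge0 L0 (ltW tau0).
  lra.
Qed.

(** [comparison] for two discrete solutions with nested steps, from arbitrary
    indices p and r: r = 0 and p = 0 compare solutions with different steps,
    m = 1 compares a solution with its shift. *)
Lemma discrete_comparison K0 K1 K2 T : exists2 C : R, 0 <= C &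
  forall tau eta m um1 v0 U um1' v0' V,
  admissible K0 K1 K2 tau um1 v0 ->
  admissible K0 K1 K2 eta um1' v0' ->
  discrete_solution E tau um1 v0 U -> discrete_solution E eta um1' v0' V ->
  tau = m%:R * eta ->
  forall p r n : nat, (p + n)%:R * tau <= T -> (r + n * m)%:R * eta <= T ->
  mdist (U (p + n)%N) (V (r + n * m)%N) ^+ 2
    <= expR (12 * (- lambda) * (n%:R * tau))
       * (mdist (U p) (V r) ^+ 2 + C * tau).
Proof.
have [B B0 hB] := discrete_bound K0 K1 K2 T.
pose Th := `|K2| * (1 + 4 * B + `|K2| * tau_max) + 4 * B.
have tm0 := htau_max.
have Th0 : 0 <= Th.
  have h : 0 <= `|K2| * tau_max by rewrite mulr_ge0// ltW.
  by rewrite /Th addr_ge0 ?mulr_ge0// !addr_ge0// mulr_ge0.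
exists (15 * B + Th); first by rewrite addr_ge0// mulr_ge0.
(* The first increment only satisfies d(um1, v0) <= K2 tau; the induction of
   [perturbed_euler] starts with the error theta0 = Th tau. *)
have first_step tau um1 v0 U w : admissible K0 K1 K2 tau um1 v0 ->
    discrete_solution E tau um1 v0 U -> 0 <= T ->
    mdist x_ref w ^+ 2 <= B -> - B <= e w ->
    mdist (U 0%N) w ^+ 2 - mdist um1 w ^+ 2
      <= 2 * tau * (e w - e (U 0%N)) + Th * tau.
  move=> adm dU T0 hw1 hw2.
  have [|hx /andP[_ he] _] := hB _ _ _ _ adm dU 0%N; first by rewrite mul0r.
  have [/andP[tau0 taum] _ _ hd] := adm; have [U0 _] := dU.
  rewrite U0 in hx he *.
  have h1 : mdist v0 w ^+ 2 <= 4 * B.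
    have := sqr_mdist_triangle x_ref v0 w; rewrite (metric_sym v0 x_ref); lra.
  have hd' : mdist um1 v0 <= `|K2| * tau.
    by rewrite (le_trans hd)// ler_pM2r// ler_norm.
  have h2 := metric_triangle v0 um1 w; rewrite (metric_sym v0 um1) in h2.
  have a0 := mdist_ge0 v0 w; have b0 := mdist_ge0 um1 w.
  have d0 := mdist_ge0 um1 v0.
  move: h1 hd' h2 a0 b0 d0.
  set a := mdist v0 w; set b := mdist um1 w; set d := mdist um1 v0.
  move=> h1 hd' h2 a0 b0 d0.
  have ha : 2 * a <= 1 + 4 * B by have := sqr_ge0 (a - 1); lra.
  have h3 : a ^+ 2 - b ^+ 2 <= d * (2 * a + d).
    have [ad|ad] := leP a d.
      have : a ^+ 2 <= d ^+ 2 by rewrite lerXn2r// nnegrE.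
      have := mulr_ge0 d0 a0; have := sqr_ge0 b; lra.
    have h3' : (a - d) ^+ 2 <= b ^+ 2 by rewrite lerXn2r ?nnegrE//; lra.
    have := sqr_ge0 d; lra.
  have h4 : d * (2 * a + d) <= `|K2| * tau * (1 + 4 * B + `|K2| * tau_max).
    apply: ler_pM => //; first by lra.
    apply: lerD => //; apply: le_trans hd' _.
    by rewrite ler_wpM2l// ltW.
  have h5 : - (2 * B) * (2 * tau) <= (e w - e v0) * (2 * tau).
    have {}he : e v0 <= B := he.
    by rewrite ler_wpM2r; lra.
  have -> : Th * tau = `|K2| * tau * (1 + 4 * B + `|K2| * tau_max) + 4 * B * tau.
    by rewrite /Th; ring.
  lra.
move=> tau eta m um1 v0 U um1' v0' V admU admV dU dV tauE p r n pnT rnT.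
have [/andP[tau0 taum] _ _ _] := admU; have [/andP[eta0 etam] _ _ _] := admV.
have T0 : 0 <= T by apply: le_trans pnT; rewrite mulr_ge0// ltW.
have [d1 d0] := admissible_domain _ _ _ _ _ _ admU.
have [d1' d0'] := admissible_domain _ _ _ _ _ _ admV.
have trU := discrete_trajectory
  tau um1 v0 U (introT andP (conj tau0 taum)) d1 d0 dU.
have trV := discrete_trajectory
  eta um1' v0' V (introT andP (conj eta0 etam)) d1' d0' dV.
have mu0 : 0 <= - lambda by rewrite oppr_ge0.
have mut t : t < tau_max -> - lambda * t <= 1 / 2.
  move=> tm; rewrite div1r; apply: le_trans hlambda_tau.
  by rewrite ler_wpM2l// ltW.
have m_gt0 : (0 < m)%N.
  by rewrite lt0n; apply: contraTneq tau0 => m0; rewrite tauE m0 mul0r ltxx.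
have etatau : eta <= tau by rewrite tauE ler_peMl// ?ler1n// ltW.
have hU k : (k <= p + n)%N -> [/\ mdist x_ref (U k) ^+ 2 <= B,
    - B <= e (U k) <= B & path_energy (history um1 U) k.+1 <= B * tau].
  move=> kpn; apply: (hB _ _ _ _ admU dU); apply: le_trans pnT.
  by rewrite ler_pM2r// ler_nat.
have hV k : (k <= r + n * m)%N -> [/\ mdist x_ref (V k) ^+ 2 <= B,
    - B <= e (V k) <= B & path_energy (history um1' V) k.+1 <= B * eta].
  move=> kpn; apply: (hB _ _ _ _ admV dV); apply: le_trans rnT.
  by rewrite ler_pM2r// ler_nat.
pose ZU := history um1 U; pose ZV := history um1' V.
pose f j := e (U (p + j)%N); pose g k := e (V (r + k)%N).
pose Y k := - g k + path_energy ZV (r + k) / (4 * eta).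
pose alpha j := memory ZU (Th * tau) (p + j).+1.
pose beta k := memory ZV (Th * eta) (r + k).+1.
have PU k : (k <= p + n)%N -> forall w, domain E w ->
    mdist x_ref w ^+ 2 <= B -> - B <= e w ->
    mdist (U k.+1) w ^+ 2 - mdist (U k) w ^+ 2
      <= 2 * tau * (e w - e (U k.+1))
         + 2 * (- lambda) * tau * mdist (U k.+1) w ^+ 2
         + memory ZU (Th * tau) k.+1.
  move=> kpn w dw hw1 hw2.
  apply: (perturbed_euler _ _ _ _ ZU tau0 mu0 (mut _ taum) trU (Th * tau) w
    k.+1 dw).
  exact: (first_step _ _ _ _ _ admU dU T0 hw1 hw2).
have PV k : (k <= r + n * m)%N -> forall w, domain E w ->
    mdist x_ref w ^+ 2 <= B -> - B <= e w ->
    mdist (V k.+1) w ^+ 2 - mdist (V k) w ^+ 2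
      <= 2 * eta * (e w - e (V k.+1))
         + 2 * (- lambda) * eta * mdist (V k.+1) w ^+ 2
         + memory ZV (Th * eta) k.+1.
  move=> kpn w dw hw1 hw2.
  apply: (perturbed_euler _ _ _ _ ZV eta0 mu0 (mut _ etam) trV (Th * eta) w
    k.+1 dw).
  exact: (first_step _ _ _ _ _ admV dV T0 hw1 hw2).
have := comparison (fun j => U (p + j)%N) (fun k => V (r + k)%N) f g Y alpha
  beta tau eta (- lambda) m n eta0 mu0 (mut _ taum) tauE.
rewrite !addn0 => /(_ _ _ _ _ _ _)/le_trans; apply.
- move=> j k jn kn; rewrite /f addnS.
  have rk : (r + k <= r + n * m)%N by rewrite leq_add2l.
  have [h1 /andP[h2 _] _] := hV _ rk.
  apply: (PU _ _ (V (r + k)%N)) => //; first by rewrite leq_add2l ltnW.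
  exact: (trV.1 (r + k).+1).
- move=> j k jn kn; rewrite /g addnS.
  have pj : (p + j <= p + n)%N by rewrite leq_add2l.
  have [h1 /andP[h2 _] _] := hU _ pj.
  apply: (PV _ _ (U (p + j)%N)) => //; first by rewrite leq_add2l ltnW.
  exact: (trU.1 (p + j).+1).
- move=> k kn.
  have h : eta * e (V (r + k).+1) + mdist (ZV (r + k).+1) (ZV (r + k).+2) ^+ 2
      <= eta * e (V (r + k)%N)
         + 1 / 4 * mdist (ZV (r + k)%N) (ZV (r + k).+1) ^+ 2.
    exact: (bdf2_dissipation_step _ _ _ _ _ (mut _ etam) trV (r + k)).
  rewrite /Y /g addnS path_energyS.
  rewrite -(ler_pM2l eta0).
  have E1 x y : eta * (- x + y / (4 * eta)) = - (eta * x) + y / 4.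
    by field; lra.
  rewrite !E1.
  have := sqr_ge0 (mdist (ZV (r + k).+1) (ZV (r + k).+2)).
  lra.
- move=> k kn; rewrite /Y !addNKr.
  rewrite ler_pM2r ?invr_gt0 ?mulr_gt0//.
  by rewrite le_path_energy// leq_add2l.
- by move=> j; apply: memory_ge0; rewrite mulr_ge0// ltW.
- by move=> j; apply: memory_ge0; rewrite mulr_ge0// ltW.
rewrite ler_wpM2l ?expR_ge0//.
have [_ _ hpU] := hU (p + n)%N (leqnn _).
have [_ hgV hpV] := hV (r + n * m)%N (leqnn _).
have [_ hgV0 _] := hV r (leq_addr _ _).
have hY : Y (n * m)%N - Y 0%N <= 2 * B + B / 4.
  rewrite /Y /g addn0.
  have h1 : path_energy ZV (r + n * m) / (4 * eta) <= B / 4.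
    rewrite ler_pdivrMr ?mulr_gt0//.
    apply: le_trans (le_path_energy _ _ _ (leqnSn _)) _.
    apply: le_trans hpV _; lra.
  have h2 : 0 <= path_energy ZV r / (4 * eta).
    by rewrite divr_ge0 ?path_energy_ge0 ?mulr_ge0// ltW.
  by move: hgV hgV0 => /andP[? ?] /andP[? ?]; lra.
have hbeta : \sum_(k < n * m) beta k <= 1 / 2 * (Th * tau) + 5 / 4 * (B * tau).
  apply: le_trans (sum_memory_le _ _ _ _ _ _ _) _.
    by rewrite mulr_ge0// ltW.
  have h1 : Th * eta <= Th * tau by rewrite ler_wpM2l.
  have h2 : B * eta <= B * tau by rewrite ler_wpM2l.
  have := le_path_energy ZV _ _ (leqnSn (r + n * m)).
  by rewrite /ZV; lra.
have halpha : \sum_(k < n) alpha k <= 1 / 2 * (Th * tau) + 5 / 4 * (B * tau).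
  apply: le_trans (sum_memory_le _ _ _ _ _ _ _) _.
    by rewrite mulr_ge0// ltW.
  have := le_path_energy ZU _ _ (leqnSn (p + n)).
  by rewrite /ZU; lra.
have hQU : path_energy (fun j => U (p + j)%N) n <= B * tau.
  rewrite (path_energy_shift ZU p.+1).
  have := path_energy_ge0 ZU p.+1; rewrite addSn; rewrite /ZU; lra.
have hQV : m%:R * path_energy (fun j => V (r + j)%N) (n * m) <= B * tau.
  rewrite (path_energy_shift ZV r.+1) tauE mulrCA ler_wpM2l//.
  have := path_energy_ge0 ZV r.+1; rewrite addSn; rewrite /ZV; lra.
have hY' : tau * (Y (n * m)%N - Y 0%N) <= tau * (2 * B + B / 4).
  by rewrite ler_pM2l.
lra.
Qed.

(** Holder continuity of exponent 1/2 in time. *)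
Lemma discrete_holder K0 K1 K2 T : exists2 B : R, 0 <= B &
  forall tau um1 v0 U, admissible K0 K1 K2 tau um1 v0 ->
  discrete_solution E tau um1 v0 U ->
  forall j k : nat, j%:R * tau <= T -> k%:R * tau <= T ->
  mdist (U j) (U k) ^+ 2 <= B * `|j%:R * tau - k%:R * tau|.
Proof.
have [B B0 hB] := discrete_bound K0 K1 K2 T.
exists B => // tau um1 v0 U adm dU.
have [/andP[tau0 taum] _ _ _] := adm.
suff H j k : (j <= k)%N -> k%:R * tau <= T ->
    mdist (U j) (U k) ^+ 2 <= B * (k%:R * tau - j%:R * tau).
  move=> j k hj hk; have [jk|/ltnW kj] := leqP j k.
    rewrite distrC ger0_norm; first exact: H.
    by rewrite subr_ge0 ler_pM2r// ler_nat.
  rewrite metric_sym ger0_norm; first exact: H.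
  by rewrite subr_ge0 ler_pM2r// ler_nat.
move=> jk hk; have [_ _ hp] := hB _ _ _ _ adm dU _ hk.
have := sqr_mdist_path (history um1 U) j.+1 (k - j).
rewrite addSn subnKC//= => /le_trans; apply.
rewrite natrB// -mulrBl mulrCA; apply: ler_wpM2l.
  by rewrite subr_ge0 ler_nat.
have := path_energy_ge0 (history um1 U) j.+1; lra.
Qed.

(** At time t the fine index lies at most m cells before the end j m of the
    coarse cell, which costs another O(sqrt tau) by [discrete_holder]. *)
Lemma discrete_rate K0 K1 K2 T : exists2 C : R, 0 <= C &
  forall tau eta m um1 v0 U um1' v0' V,
  admissible K0 K1 K2 tau um1 v0 ->
  admissible K0 K1 K2 eta um1' v0' ->
  discrete_solution E tau um1 v0 U -> discrete_solution E eta um1' v0' V ->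
  tau = m%:R * eta -> forall t, 0 <= t <= T ->
  mdist (U (grid_index tau t)) (V (grid_index eta t)) <= C * Num.sqrt tau.
Proof.
pose T' := T + tau_max.
have [C1 C10 hC1] := discrete_comparison K0 K1 K2 T'.
have [B B0 hB] := discrete_holder K0 K1 K2 T'.
pose G := expR (12 * (- lambda) * T').
pose C := 2 * (G * (4 * K0 ^+ 2 * tau_max + C1)) + 2 * B.
have tm0 := htau_max.
have q0 : 0 <= 4 * K0 ^+ 2 * tau_max + C1.
  by rewrite addr_ge0// mulr_ge0 ?(ltW tm0)// mulr_ge0// sqr_ge0.
have C0 : 0 <= C.
  by rewrite /C addr_ge0 ?mulr_ge0 ?expR_ge0.
exists (Num.sqrt C); first exact: sqrtr_ge0.
move=> tau eta m um1 v0 U um1' v0' V admU admV dU dV tauE t /andP[t0 tT].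
have [/andP[tau0 taum] hU0 _ _] := admU.
have [/andP[eta0 etam] hV0 _ _] := admV.
have m_gt0 : (0 < m)%N.
  by rewrite lt0n; apply: contraTneq tau0 => m0; rewrite tauE m0 mul0r ltxx.
have etatau : eta <= tau by rewrite tauE ler_peMl// ?ler1n// ltW.
set j := grid_index tau t; set k := grid_index eta t.
have h1 : t <= j%:R * tau := grid_index_ge _ _ tau0 t0.
have h2 : j%:R * tau < t + tau := grid_index_lt _ _ tau0 t0.
have h3 : t <= k%:R * eta := grid_index_ge _ _ eta0 t0.
have h4 : k%:R * eta < t + eta := grid_index_lt _ _ eta0 t0.
have jmE : (j * m)%:R * eta = j%:R * tau by rewrite natrM tauE mulrA.
have kjm : (k <= j * m)%N by apply: grid_index_le => //; rewrite jmE.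
have kjm' : k%:R * eta <= j%:R * tau by rewrite -jmE ler_pM2r// ler_nat.
have jT : j%:R * tau <= T' by rewrite /T'; lra.
have kT : k%:R * eta <= T' by rewrite /T'; lra.
rewrite -sqrtrM// -(@ler_sqr _ _ (Num.sqrt _)) ?nnegrE ?sqrtr_ge0 ?mdist_ge0//.
rewrite sqr_sqrtr ?mulr_ge0 ?(ltW tau0)//.
have hD : mdist (U j) (V (j * m)%N) ^+ 2
    <= G * ((4 * K0 ^+ 2 * tau_max + C1) * tau).
  have := hC1 _ _ _ _ _ _ _ _ _ admU admV dU dV tauE 0%N 0%N j.
  rewrite !add0n jmE => /(_ jT jT) /le_trans; apply.
  apply: ler_pM; rewrite ?expR_ge0 ?addr_ge0 ?sqr_ge0 ?mulr_ge0 ?(ltW tau0)//.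
    rewrite ler_expR ler_wpM2l// mulr_ge0// oppr_ge0//.
  have [U0 _] := dU; have [V0 _] := dV; rewrite U0 V0 mulrDl lerD2r.
  have K0ge : 0 <= K0.
    by have := le_trans (mdist_ge0 _ _) hU0; rewrite pmulr_lge0.
  have hUV : mdist v0 v0' <= 2 * K0 * tau.
    have := metric_triangle v0 u0 v0'; rewrite (metric_sym u0).
    have := ler_wpM2l K0ge etatau; lra.
  apply: (@le_trans _ _ ((2 * K0 * tau) ^+ 2)).
    by rewrite ler_sqr ?nnegrE ?mdist_ge0// !mulr_ge0// ltW.
  have := ler_wpM2l (mulr_ge0 (sqr_ge0 K0) (ltW tau0)) (ltW taum).
  lra.
have hH : mdist (V k) (V (j * m)%N) ^+ 2 <= B * tau.
  apply: le_trans (hB _ _ _ _ admV dV _ _ kT _) _; first by rewrite jmE.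
  rewrite jmE; apply: ler_wpM2l => //; rewrite ler_norml.
  by apply/andP; split; lra.
have := sqr_mdist_triangle (V (j * m)%N) (U j) (V k).
rewrite (metric_sym (V (j * m)%N) (V k)) /C; lra.
Qed.

(** [bdf2_evi] summed over n steps from index J.  The two squared increments
    telescope. *)
Lemma discrete_evi_sum tau um1 v0 U w J n :
  0 < tau < tau_max -> domain E um1 -> domain E v0 ->
  discrete_solution E tau um1 v0 U -> domain E w ->
  3 / 4 * mdist (history um1 U (J + n).+1) w ^+ 2
    - 1 / 4 * mdist (history um1 U (J + n)%N) w ^+ 2
    + tau * \sum_(i < n) (e (U (J + i).+1) - e w
                          + lambda / 2 * mdist (U (J + i).+1) w ^+ 2)
  <= 3 / 4 * mdist (history um1 U J.+1) w ^+ 2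
    - 1 / 4 * mdist (history um1 U J) w ^+ 2
    + 1 / 2 * mdist (history um1 U J) (history um1 U J.+1) ^+ 2.
Proof.
move=> htau d1 d0 dU dw; set Z := history um1 U.
have tr := discrete_trajectory
  tau um1 v0 U htau d1 d0 dU.
suff : 3 / 4 * mdist (Z (J + n).+1) w ^+ 2 - 1 / 4 * mdist (Z (J + n)%N) w ^+ 2
    + 1 / 2 * mdist (Z (J + n)%N) (Z (J + n).+1) ^+ 2
    + tau * \sum_(i < n) (e (U (J + i).+1) - e w
                          + lambda / 2 * mdist (U (J + i).+1) w ^+ 2)
  <= 3 / 4 * mdist (Z J.+1) w ^+ 2 - 1 / 4 * mdist (Z J) w ^+ 2
    + 1 / 2 * mdist (Z J) (Z J.+1) ^+ 2.
  have := sqr_ge0 (mdist (Z (J + n)%N) (Z (J + n).+1)); lra.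
elim: n => [|n IH]; first by rewrite big_ord0 addn0; lra.
have h := bdf2_evi _ _ _ _ _ tr (J + n) w dw.
rewrite -/Z -/(e _) -/(e _) in h.
rewrite big_ord_recr /= addnS mulrDr.
move: IH h; rewrite /=; lra.
Qed.

(** * The limit curve *)

Section limit.
Variables (tau_ : nat -> R) (um1_ v0_ : nat -> X) (U : nat -> nat -> X).
Variables (K0 K1 K2 : R) (u : R -> X).
Hypothesis hadm :
  forall n, admissible K0 K1 K2 (tau_ n) (um1_ n) (v0_ n).
Hypothesis htau : tau_ n @[n --> \oo] --> (0 : R).
Hypothesis dU :
  forall n, discrete_solution E (tau_ n) (um1_ n) (v0_ n) (U n).
Hypothesis hu : forall t, 0 <= t ->
  U n (grid_index (tau_ n) t) @[n --> \oo] --> u t.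

Hypothesis hu_le0 : forall t, t <= 0 -> u t = u0.

Let tau_gt0 n : 0 < tau_ n.
Proof. by have [/andP[]] := hadm n. Qed.

Let hbound := discrete_bound K0 K1 K2.
Let hholder := discrete_holder K0 K1 K2.

Lemma cvg_grid_index t : 0 <= t ->
  (grid_index (tau_ n) t)%:R * tau_ n @[n --> \oo] --> t.
Proof.
move=> t0.
apply: (@squeeze_cvgr _ _ _ _ (fun=> t) (fun n => t + tau_ n)).
- apply: nearW => n /=.
  by rewrite grid_index_ge//= ltW// grid_index_lt.
- exact: cvg_cst.
- by rewrite -[X in _ --> X]addr0; apply: cvgD; [exact: cvg_cst|exact: htau].
Qed.

(** Any indices k_n with k_n tau_n --> t can replace the grid index of t. *)
Lemma cvg_index (k_ : nat -> nat) t :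
  (k_ n)%:R * tau_ n @[n --> \oo] --> t -> U n (k_ n) @[n --> \oo] --> u t.
Proof.
move=> kt; have t0 : 0 <= t.
  apply: (ler_cvg_to (cvg_cst 0) kt).
  by apply: nearW => n; rewrite mulr_ge0// ltW.
have [B B0 hB] := hholder (t + 1).
have tt1 : t < t + 1 by rewrite ltrDl.
have n1 := near_le_cvg _ _ _ kt tt1.
have n2 := near_le_cvg _ _ _ (cvg_grid_index _ t0) tt1.
have h0 : mdist (U n (k_ n)) (U n (grid_index (tau_ n) t)) @[n --> \oo]
    --> (0 : R).
  apply: (@cvg_sqr0 _ _ (fun n => B * `|(k_ n)%:R * tau_ n
      - (grid_index (tau_ n) t)%:R * tau_ n|)).
    near=> n; split; first exact: mdist_ge0.
    by apply: (hB _ _ _ _ (hadm n) (dU n)); near: n.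
  rewrite -(mulr0 B); apply: cvgMl_tmp; rewrite -(normr0 R) -(subrr t).
  by apply: cvg_norm; apply: cvgB => //; exact: cvg_grid_index.
apply/cvg_mdistP; have /cvg_mdistP hut := hu _ t0.
apply: (@squeeze_cvgr _ _ _ _ (fun=> 0) (fun n =>
  mdist (U n (k_ n)) (U n (grid_index (tau_ n) t))
  + mdist (U n (grid_index (tau_ n) t)) (u t))).
- by apply: nearW => n; rewrite mdist_ge0 metric_triangle.
- exact: cvg_cst.
- by rewrite -[X in _ --> X](addr0 0); exact: cvgD.
Unshelve. all: by end_near. Qed.

Lemma limit_holder T : exists2 B : R, 0 <= B & forall s t,
  0 <= s <= T -> 0 <= t <= T -> mdist (u s) (u t) ^+ 2 <= B * `|s - t|.
Proof.
have [B B0 hB] := hholder (T + 1).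
exists B => // s t /andP[s0 sT] /andP[t0 tT].
have cs := cvg_grid_index _ s0; have ct := cvg_grid_index _ t0.
have T1 : T < T + 1 by rewrite ltrDl.
have n1 := near_le_cvg _ _ _ cs (le_lt_trans sT T1).
have n2 := near_le_cvg _ _ _ ct (le_lt_trans tT T1).
apply: (@ler_cvgn _ (fun n => mdist (U n (grid_index (tau_ n) s))
  (U n (grid_index (tau_ n) t)) ^+ 2) (fun n =>
  B * `|(grid_index (tau_ n) s)%:R * tau_ n
        - (grid_index (tau_ n) t)%:R * tau_ n|)).
- by apply: cvg_sqr; apply: cvg_mdist; exact: hu.
- by apply: cvgMl_tmp; apply: cvg_norm; exact: cvgB.
- by near=> n; apply: (hB _ _ _ _ (hadm n) (dU n)); near: n.
Unshelve. all: by end_near. Qed.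

(** The limit of [discrete_comparison] between U and its shift by h. *)
Lemma limit_contraction s r h : 0 <= s -> 0 <= r -> 0 <= h ->
  mdist (u (s + r)) (u (s + h + r)) ^+ 2
    <= expR (12 * (- lambda) * r) * mdist (u s) (u (s + h)) ^+ 2.
Proof.
move=> s0 r0 h0; pose T := s + r + h + 1.
have [C C0 hC] := discrete_comparison K0 K1 K2 T.
pose J n := grid_index (tau_ n) s; pose N n := grid_index (tau_ n) r.
pose I n := grid_index (tau_ n) h.
have cJ : (J n)%:R * tau_ n @[n --> \oo] --> s := cvg_grid_index _ s0.
have cN : (N n)%:R * tau_ n @[n --> \oo] --> r := cvg_grid_index _ r0.
have cI : (I n)%:R * tau_ n @[n --> \oo] --> h := cvg_grid_index _ h0.
have cJN : (J n + N n)%:R * tau_ n @[n --> \oo] --> s + r.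
  by under eq_fun do rewrite natrD mulrDl; exact: cvgD.
have cJI : (J n + I n)%:R * tau_ n @[n --> \oo] --> s + h.
  by under eq_fun do rewrite natrD mulrDl; exact: cvgD.
have cJIN : (J n + I n + N n * 1)%:R * tau_ n @[n --> \oo] --> s + h + r.
  by under eq_fun do rewrite muln1 natrD mulrDl; exact: cvgD.
have n1 : \forall n \near \oo, (J n + N n)%:R * tau_ n <= T.
  by apply: near_le_cvg cJN _; rewrite /T; lra.
have n2 : \forall n \near \oo, (J n + I n + N n * 1)%:R * tau_ n <= T.
  by apply: near_le_cvg cJIN _; rewrite /T; lra.
apply: (@ler_cvgn _
  (fun n => mdist (U n (J n + N n)%N) (U n (J n + I n + N n * 1)%N) ^+ 2)
  (fun n => expR (12 * (- lambda) * ((N n)%:R * tau_ n))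
     * (mdist (U n (J n)) (U n (J n + I n)%N) ^+ 2 + C * tau_ n))).
- by apply: cvg_sqr; apply: cvg_mdist; exact: cvg_index.
- apply: cvgM.
    apply: continuous_cvg; first exact: continuous_expR.
    exact: cvgMl_tmp.
  rewrite -[X in _ --> X]addr0; apply: cvgD.
    by apply: cvg_sqr; apply: cvg_mdist; exact: cvg_index.
  by rewrite -(mulr0 C); apply: cvgMl_tmp; exact: htau.
- near=> n; apply: (hC _ _ _ _ _ _ _ _ _ (hadm n) (hadm n) (dU n) (dU n)).
  + by rewrite mul1r.
  + by near: n.
  + by near: n.
Unshelve. all: by end_near. Qed.

(** The quadratic variation of u along a grid of step h is O(h). *)
Lemma limit_path_energy T : exists2 B : R, 0 <= B & forall h (N : nat),
  0 <= h -> N%:R * h <= T ->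
  \sum_(i < N) mdist (u (i%:R * h)) (u (i.+1%:R * h)) ^+ 2 <= B * h.
Proof.
have [B B0 hB] := hbound (T + 1).
exists B => // h N h0 hN.
pose I n := grid_index (tau_ n) h.
have cI : (I n)%:R * tau_ n @[n --> \oo] --> h := cvg_grid_index _ h0.
have ci i : (i * I n)%:R * tau_ n @[n --> \oo] --> i%:R * h.
  by under eq_fun do rewrite natrM -mulrA; exact: cvgMl_tmp.
have n1 : \forall n \near \oo, (N * I n)%:R * tau_ n <= T + 1.
  by apply: near_le_cvg (ci N) _; rewrite (le_lt_trans hN)// ltrDl.
apply: (@ler_cvgn _
  (fun n => \sum_(i < N) mdist (U n (i * I n)%N) (U n (i.+1 * I n)%N) ^+ 2)
  (fun n => B * ((I n)%:R * tau_ n))).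
- apply: cvg_big => [|i _]; first exact: tvs.add_continuous.
  by apply: cvg_sqr; apply: cvg_mdist; exact: cvg_index.
- exact: cvgMl_tmp.
near=> n.
have nT : (N * I n)%:R * tau_ n <= T + 1 by near: n.
have [_ _ hp] := hB _ _ _ _ (hadm n) (dU n) _ nT.
pose Z := history (um1_ n) (U n).
rewrite mulrCA; apply: (@le_trans _ _ ((I n)%:R * path_energy Z (N * I n).+1));
  last by rewrite ler_wpM2l.
suff : \sum_(i < N) mdist (U n (i * I n)%N) (U n (i.+1 * I n)%N) ^+ 2
    <= (I n)%:R * (path_energy Z (N * I n).+1 - path_energy Z 1).
  move=> /le_trans; apply; rewrite ler_wpM2l// gerBl; exact: path_energy_ge0.
elim: (N) => [|k IH]; first by rewrite big_ord0 mul0n subrr mulr0.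
rewrite big_ord_recr /=.
have := sqr_mdist_path Z (k * I n).+1 (I n).
rewrite addSn -mulSnr /=; move: IH; lra.
Unshelve. all: by end_near. Qed.

Lemma limit_continuous x eps : 0 < eps ->
  \forall y \near x, mdist (u x) (u y) < eps.
Proof.
move=> eps0; have [B B0 hB] := limit_holder (`|x| + 1).
have uE t : u t = u (Num.max t 0).
  have [t0|t0] := leP t 0; last by [].
  by rewrite !hu_le0.
have ex1 : `|x| < `|x| + 1 by rewrite ltrDl.
have d0 : 0 < eps ^+ 2 / (B + 1) by rewrite divr_gt0 ?exprn_gt0// ltr_wpDl.
near=> y.
have h1 : `|x - y| < 1 by near: y; exact: nbhsx_ballx.
have h2 : `|x - y| < eps ^+ 2 / (B + 1).
  by near: y; exact: nbhsx_ballx.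
rewrite (uE x) (uE y) -(@ltr_pXn2r _ 2) ?nnegrE ?mdist_ge0 ?(ltW eps0)//.
apply: le_lt_trans (hB _ _ _ _) _.
- rewrite le_max lexx orbT /= ge_max (le_trans (ler_norm _) (ltW ex1)) /=.
  by rewrite addr_ge0.
- rewrite le_max lexx orbT /= ge_max; apply/andP; split; last first.
    by rewrite addr_ge0.
  have := ler_norm x; have := ler_norm (y - x); rewrite distrC.
  lra.
have h3 : `|Num.max x 0 - Num.max y 0| <= `|x - y|.
  have n1 := ler_norm (x - y); have n2 := ler_norm (y - x).
  rewrite distrC in n2; have n0 := normr_ge0 (x - y).
  by rewrite ler_norml; have [x0|x0] := leP x 0; have [y0|y0] := leP y 0;
    apply/andP; split; lra.
apply: (@le_lt_trans _ _ (B * `|x - y|)); first by rewrite ler_wpM2l.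
apply: (@le_lt_trans _ _ ((B + 1) * `|x - y|)).
  by rewrite ler_wpM2r// lerDl.
by rewrite mulrC -ltr_pdivlMr// ltr_wpDl.
Unshelve. all: by end_near. Qed.

Lemma continuous_mdist_limit w : continuous (fun r => mdist (u r) w : R).
Proof.
move=> x; apply/cvgrPdist_lt => eps eps0.
near=> y; apply: (@le_lt_trans _ _ (mdist (u x) (u y))).
  by apply: le_trans (ler_dist_mdist _ _ _ _) _; rewrite mdistxx addr0.
by near: y; exact: limit_continuous.
Unshelve. all: by end_near. Qed.

Lemma measurable_energy_limit : measurable_fun setT (fun r => E (u r)).
Proof.
apply: lower_semicontinuous_measurable => x a ax.
have [d d0 hd] := seq_lsc_near _ _ _ _ _ hE1 ax.
exists [set y | mdist (u x) (u y) < d]; first exact: limit_continuous.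
by move=> y /= /hd.
Qed.

Lemma limit_energy_bound T : exists2 B : R, 0 <= B &
  forall r, 0 <= r <= T -> (E (u r) <= B%:E)%E.
Proof.
have [B B0 hB] := hbound (T + 1).
exists B => // r /andP[r0 rT].
apply: (seq_lsc_le _ _ _ _ hE1 (hu _ r0)).
have n1 : \forall n \near \oo, (grid_index (tau_ n) r)%:R * tau_ n <= T + 1.
  apply: near_le_cvg (cvg_grid_index _ r0) _.
  by rewrite (le_lt_trans rT)// ltrDl.
near=> n.
have nT : (grid_index (tau_ n) r)%:R * tau_ n <= T + 1 by near: n.
have [_ /andP[_ he] _] := hB _ _ _ _ (hadm n) (dU n) _ nT.
have [d1 d0] := admissible_domain _ _ _ _ _ _ (hadm n).
have [htn _ _ _] := hadm n.
have tr := discrete_trajectory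
  _ _ _ _ htn d1 d0 (dU n).
by rewrite (domain_fine _ hE _ (tr.1 _.+1)) lee_fin.
Unshelve. all: by end_near. Qed.

(** The preceding iterates have the same limit. *)
Lemma cvg_history (k_ : nat -> nat) t :
  (k_ n)%:R * tau_ n @[n --> \oo] --> t ->
  history (um1_ n) (U n) (k_ n) @[n --> \oo] --> u t /\
  mdist (history (um1_ n) (U n) (k_ n)) (U n (k_ n)) @[n --> \oo] --> (0 : R).
Proof.
move=> kt; have [B B0 hB] := hbound (t + 1).
have tt1 : t < t + 1 by rewrite ltrDl.
have n1 := near_le_cvg _ _ _ kt tt1.
have h0 : mdist (history (um1_ n) (U n) (k_ n)) (U n (k_ n)) @[n --> \oo]
    --> (0 : R).
  apply: (@cvg_sqr0 _ _ (fun n => B * tau_ n)); last first.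
    by rewrite -(mulr0 B); apply: cvgMl_tmp; exact: htau.
  near=> n; split; first exact: mdist_ge0.
  have nT : (k_ n)%:R * tau_ n <= t + 1 by near: n.
  have [_ _] := hB _ _ _ _ (hadm n) (dU n) _ nT.
  rewrite path_energyS; apply: le_trans.
  by rewrite lerDr; exact: path_energy_ge0.
split=> //; apply/cvg_mdistP.
have /cvg_mdistP hut := cvg_index _ _ kt.
apply: (@squeeze_cvgr _ _ _ _ (fun=> 0) (fun n =>
  mdist (history (um1_ n) (U n) (k_ n)) (U n (k_ n))
  + mdist (U n (k_ n)) (u t))).
- by apply: nearW => n; rewrite mdist_ge0 metric_triangle.
- exact: cvg_cst.
- by rewrite -[X in _ --> X](addr0 0); exact: cvgD.
Unshelve. all: by end_near. Qed.

(** The integrand of the variational inequality, up to sign, plus a constant M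
    that makes it nonnegative. *)
Let shifted (w : X) (M : R) (z : X) : R :=
  e z - e w + lambda / 2 * mdist z w ^+ 2 + M.

Lemma near_index_le t : 0 <= t -> \forall n \near \oo,
  (grid_index (tau_ n) t)%:R * tau_ n <= t + 1.
Proof.
by move=> t0; apply: near_le_cvg (cvg_grid_index _ t0) _; rewrite ltrDl.
Qed.

Lemma shift_exists t w : exists M, forall z, mdist x_ref z ^+ 2 <= t ->
  - t <= e z -> 0 <= shifted w M z.
Proof.
exists (t + `|e w| - lambda / 2 * (2 * t + 2 * mdist x_ref w ^+ 2)) => z h1 h2.
rewrite /shifted.
have h3 : mdist z w ^+ 2 <= 2 * t + 2 * mdist x_ref w ^+ 2.
  have := sqr_mdist_triangle x_ref z w; rewrite (metric_sym z x_ref); lra.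
have l2 : 0 <= - (lambda / 2) by have := hlambda; lra.
have := ler_wpM2l l2 h3; have := ler_norm (e w); lra.
Qed.

Lemma limit_bound t : exists2 B : R, 0 <= B & forall r, 0 <= r <= t ->
  [/\ domain E (u r), mdist x_ref (u r) ^+ 2 <= B & - B <= e (u r)].
Proof.
have [B B0 hB] := hbound (t + 1); have [B' B'0 hB'] := limit_energy_bound t.
have [c hc] := coercivity_real _ _ _ _ _ hE hE2.
have Bc0 : 0 <= B / (2 * tau_max) by rewrite divr_ge0 ?mulr_ge0// ltW.
exists (B + (`|c| + B / (2 * tau_max))); first by rewrite !addr_ge0.
move=> r /andP[r0 rt].
have dr : domain E (u r).
  by apply: le_lt_trans (ltry B'); apply: hB'; rewrite r0.
have hx : mdist x_ref (u r) ^+ 2 <= B.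
  apply: (@ler_cvgn _ (fun n =>
     mdist x_ref (U n (grid_index (tau_ n) r)) ^+ 2) (fun=> B)).
  - by apply: cvg_sqr; apply: cvg_mdist; [exact: cvg_cst|exact: hu].
  - exact: cvg_cst.
  - near=> n.
    have nT : (grid_index (tau_ n) r)%:R * tau_ n <= t + 1.
      apply: (@le_trans _ _ (r + 1)); last by rewrite lerD2r.
      by near: n; exact: near_index_le.
    by have [] := hB _ _ _ _ (hadm n) (dU n) _ nT.
split => //; first by rewrite (le_trans hx)// lerDl addr_ge0.
have := hc _ dr; have := ler_norm (- c); rewrite normrN.
have : mdist x_ref (u r) ^+ 2 / (2 * tau_max) <= B / (2 * tau_max).
  by rewrite ler_pM2r// invr_gt0 mulr_gt0.
rewrite -/(e _); lra.
Unshelve. all: by end_near. Qed.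

(** Lower semicontinuity of the shifted integrand along the iterates. *)
Lemma shifted_near_ge w M r : domain E w -> 0 <= r -> domain E (u r) ->
  forall eps, 0 < eps -> \forall n \near \oo,
    shifted w M (u r) - eps <= shifted w M (U n (grid_index (tau_ n) r)).
Proof.
move=> dw r0 dr eps eps0; have e2 : 0 < eps / 2 by rewrite divr_gt0.
have n1 : \forall n \near \oo,
    ((e (u r) - eps / 2)%:E < E (U n (grid_index (tau_ n) r)))%E.
  apply: (seq_lsc_gt _ _ _ _ _ _ hE1 (hu _ r0)).
  by rewrite (domain_fine _ hE _ dr) lte_fin -/(e _); lra.
have c2 : lambda / 2 * mdist (U n (grid_index (tau_ n) r)) w ^+ 2
    @[n --> \oo] --> lambda / 2 * mdist (u r) w ^+ 2.
  apply: cvgMl_tmp; apply: cvg_sqr; apply: cvg_mdist; last exact: cvg_cst.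
  exact: hu.
have /cvgrPdist_lt/(_ _ e2) n2 := c2.
near=> n.
have [d1 d0] := admissible_domain _ _ _ _ _ _ (hadm n).
have [htn _ _ _] := hadm n.
have tr := discrete_trajectory
  _ _ _ _ htn d1 d0 (dU n).
have : ((e (u r) - eps / 2)%:E < E (U n (grid_index (tau_ n) r)))%E by near: n.
rewrite (domain_fine _ hE _ (tr.1 _.+1)) lte_fin -/(e _) => h1.
have : `|lambda / 2 * mdist (u r) w ^+ 2
   - lambda / 2 * mdist (U n (grid_index (tau_ n) r)) w ^+ 2| < eps / 2 by near: n.
rewrite ltr_norml /shifted => /andP[h2 h3].
move: h1 => /=; lra.
Unshelve. all: by end_near. Qed.

(** Fatou's lemma on ]s, t[ for the step functions whose cells cover it: their
    integrals are the sums bounded by [discrete_evi_sum]. *)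
Lemma limit_evi s t w : 0 <= s -> s <= t -> domain E w ->
  ((2^-1 * mdist (u t) w ^+ 2 - 2^-1 * mdist (u s) w ^+ 2)%:E
     <= \int[lebesgue_measure]_(r in `[s, t])
          (E w - E (u r) - (lambda / 2 * mdist (u r) w ^+ 2)%:E))%E.
Proof.
move=> s0 st dw; have t0 : 0 <= t := le_trans s0 st.
have [B1 B10 hB1] := hbound (t + 1); have [B2 B20 hB2] := limit_bound t.
have [M hM] := shift_exists (B1 + B2) w.
pose D : set R := `]s, t[%classic.
have hD r : D r -> s < r < t by rewrite /D /= in_itv.
have dom_ur r : D r -> [/\ 0 <= r, domain E (u r) & 0 <= shifted w M (u r)].
  move=> /hD /andP[sr rt]; have r0 : 0 <= r := le_trans s0 (ltW sr).
  have [|dr h1 h2] := hB2 r; first by rewrite r0 ltW.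
  by split => //; apply: hM; lra.
have cE r : E w = (e w)%:E by exact: domain_fine.
pose g r := fine (E (u r)) + (lambda / 2 * mdist (u r) w ^+ 2 - e w + M).
have gE r : g r = shifted w M (u r) by rewrite /g /shifted /e; ring.
have md2 : measurable_fun setT (fun r => mdist (u r) w ^+ 2 : R).
  have := continuous_measurable_fun (continuous_mdist_limit w).
  by move=> mc; under eq_fun do rewrite expr2; exact: measurable_funM.
have mg : measurable_fun setT g.
  rewrite /g; apply: measurable_funD.
    apply: measurableT_comp; first exact: fine_measurable.
    exact: measurable_energy_limit.
  apply: measurable_funD; last exact: measurable_cst.
  apply: measurable_funB; last exact: measurable_cst.
  by apply: measurable_funM; first exact: measurable_cst.
pose J n := grid_index (tau_ n) s; pose N n := grid_index (tau_ n) t.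
have cJ : (J n)%:R * tau_ n @[n --> \oo] --> s := cvg_grid_index _ s0.
have cN : (N n)%:R * tau_ n @[n --> \oo] --> t := cvg_grid_index _ t0.
have JN n : (J n <= N n)%N by exact: grid_index_mono.
(* The maximum with 0 is inactive for large n. *)
pose phi n i := Num.max 0 (shifted w M (U n (J n + i).+1)).
pose F n r := (step_fun (tau_ n) (J n) (N n - J n) (phi n) r)%:E.
have phi0 n i : (i < N n - J n)%N -> 0 <= phi n i by rewrite /phi le_max lexx.
pose P n k := 3 / 4 * mdist (U n k) w ^+ 2
              - 1 / 4 * mdist (history (um1_ n) (U n) k) w ^+ 2.
pose b n := P n (J n)
  + 1 / 2 * mdist (history (um1_ n) (U n) (J n)) (U n (J n)) ^+ 2 - P n (N n)
  + ((N n)%:R * tau_ n - (J n)%:R * tau_ n) * M.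
pose l := 2^-1 * mdist (u s) w ^+ 2 - 2^-1 * mdist (u t) w ^+ 2 + (t - s) * M.
have cP k_ r : (k_ n)%:R * tau_ n @[n --> \oo] --> r ->
    P n (k_ n) @[n --> \oo] --> 2^-1 * mdist (u r) w ^+ 2.
  move=> kr; have [h1 _] := cvg_history _ _ kr.
  rewrite (_ : 2^-1 * _ = 3 / 4 * mdist (u r) w ^+ 2
     - 1 / 4 * mdist (u r) w ^+ 2); last by lra.
  apply: cvgB; apply: cvgMl_tmp; apply: cvg_sqr; apply: cvg_mdist => //.
  - exact: cvg_index.
  - exact: cvg_cst.
  - exact: cvg_cst.
have cb : b n @[n --> \oo] --> l.
  rewrite /b /l; apply: cvgD; last by apply: cvgMr_tmp; exact: cvgB.
  apply: cvgB; last exact: cP.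
  rewrite -[X in _ --> X]addr0; apply: cvgD; first exact: cP.
  rewrite -(mulr0 (1 / 2)); apply: cvgMl_tmp.
  have -> : (0 : R) = 0 ^+ 2 by rewrite expr0n.
  by apply: cvg_sqr; have [] := cvg_history _ _ cJ.
have mgD : measurable_fun D g by exact: measurable_funTS.
have hint : (\int[lebesgue_measure]_(r in D) (g r)%:E <= l%:E)%E.
  have mD : measurable D by exact: measurable_itv.
  apply: (fatou_le _ D (fun r => (g r)%:E) F b l mD).
  - exact/measurable_EFinP.
  - move=> n; have := measurable_step_fun (tau_ n) (J n) (N n - J n) (phi n) D.
    by move=> /measurable_EFinP.
  - by move=> r /dom_ur[_ _]; rewrite lee_fin gE.
  - by move=> n r _; rewrite lee_fin step_fun_ge0//; exact: phi0.
  - move=> r Dr; have [r0 dr _] := dom_ur _ Dr; have /andP[sr rt] := hD _ Dr.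
    apply/lee_subgt0Pr => eps eps0; apply: limn_einf_ge.
    have n1 : \forall n \near \oo, (J n)%:R * tau_ n <= (s + r) / 2.
      by apply: near_le_cvg cJ _; lra.
    have n2 := shifted_near_ge w M r dw r0 dr _ eps0.
    near=> n.
    have nJ : (J n)%:R * tau_ n <= (s + r) / 2 by near: n.
    pose k := grid_index (tau_ n) r.
    have k1 : r <= k%:R * tau_ n by exact: grid_index_ge.
    have k2 : k%:R * tau_ n < r + tau_ n by exact: grid_index_lt.
    have Jk : (J n < k)%N.
      by rewrite -(ltr_nat R) -(ltr_pM2r (tau_gt0 n)); lra.
    have kN : (k <= N n)%N by apply: grid_index_mono => //; exact: ltW.
    have hk : shifted w M (u r) - eps <= shifted w M (U n k).
      by rewrite /k; near: n.
    pose i := (k - (J n).+1)%N.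
    have iE : (J n + i).+1 = k by rewrite -addSn subnKC.
    have iN : (i < N n - J n)%N.
      by rewrite -(ltn_add2l (J n)) subnKC// -ltnS iE ltnS.
    rewrite -EFinB lee_fin.
    apply: le_trans (step_fun_ge (tau_ n) (J n) (N n - J n) (phi n) (phi0 n)
      i r iN _).
      by rewrite /phi iE le_max gE; apply/orP; right.
    rewrite iE k1 andbT.
    have kE : k%:R = (J n + i)%:R + 1 :> R by rewrite natr1 iE.
    by move: k2; rewrite kE; lra.
  - near=> n.
    apply: le_trans (integral_step_fun (tau_ n) (J n) (N n - J n) (phi n)
      (phi0 n) D _ (tau_gt0 n)) _; first exact: measurable_itv.
    rewrite lee_fin.
    have nT : (N n)%:R * tau_ n <= t + 1 by near: n; exact: near_index_le.
    have phiE i : (i < N n - J n)%N -> phi n i = shifted w M (U n (J n + i).+1).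
      move=> iN; apply/max_idPr; rewrite /phi.
      have [|h1 /andP[h2 _] _] := hB1 _ _ _ _ (hadm n) (dU n) (J n + i).+1.
        apply: le_trans nT; rewrite ler_pM2r// ler_nat -addnS.
        by rewrite -(subnKC (JN n)) leq_add2l.
      have {}h2 : - B1 <= e (U n (J n + i).+1) := h2.
      by apply: hM; lra.
    rewrite (eq_bigr (fun i : 'I_(N n - J n) => (e (U n (J n + i).+1) - e w
       + lambda / 2 * mdist (U n (J n + i).+1) w ^+ 2) + M)); last first.
      by move=> i _; rewrite phiE.
    rewrite big_split /= sumr_const card_ord mulrDr.
    have [d1 d0] := admissible_domain _ _ _ _ _ _ (hadm n).
    have [htn _ _ _] := hadm n.
    have := discrete_evi_sum
      _ _ _ _ w (J n) (N n - J n) htn d1 d0 (dU n) dw.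
    rewrite subnKC//= -/e.
    have -> : M *+ (N n - J n) = ((N n)%:R - (J n)%:R) * M.
      by rewrite -natrB// mulr_natl.
    rewrite /b /P /e; lra.
  - exact: cb.
have := le_integral_cst_sub R s t M l g st mgD _ hint.
have g0 r : s < r < t -> 0 <= g r.
  by move=> sr; have [|_ _] := dom_ur r; [rewrite /D /= in_itv|rewrite gE].
move=> /(_ g0) hfin.
have lE : M * (t - s) - l
    = 2^-1 * mdist (u t) w ^+ 2 - 2^-1 * mdist (u s) w ^+ 2.
  by rewrite /l; lra.
rewrite lE in hfin; apply: le_trans hfin _.
have integrandE r : D r -> ((M - g r)%:E
    = E w - E (u r) - (lambda / 2 * mdist (u r) w ^+ 2)%:E)%E.
  move=> /dom_ur[_ dr _]; rewrite (domain_fine _ hE _ dw).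
  rewrite (domain_fine _ hE _ dr) -!EFinB; congr (_%:E).
  by rewrite /g /e; ring.
rewrite [X in (_ <= X)%E]integral_itv_bndoo; last first.
  apply: (@eq_measurable_fun _ _ _ _ D (fun r => (M - g r)%:E)).
    by move=> r; rewrite inE => Dr; rewrite integrandE.
  apply/measurable_EFinP; apply: measurable_funTS.
  by apply: measurable_funB => //; exact: measurable_cst.
rewrite le_eqVlt; apply/orP; left; apply/eqP. apply: eq_integral => r.
by rewrite inE => Dr; rewrite integrandE.
Unshelve. all: by end_near. Qed.

End limit.

End discrete.

(** * Convergence to the gradient flow *)

Lemma cvg_uniform_mdist (R : realType) (X : metricType R) (A : set R)
    (g : nat -> R -> X) (f : R -> X) (a : nat -> R) :
  a n @[n --> \oo] --> (0 : R) ->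
  (forall n t, A t -> mdist (g n t) (f t) <= a n) ->
  {uniform A, g n @[n --> \oo] --> f}.
Proof.
move=> a0 gf P /uniform_nbhs[Q [entQ QP]].
move: entQ; rewrite -entourage_ballE => -[eps /= eps0 epsQ].
have n1 := near_le_cvg _ _ _ a0 (_ : 0 < eps / 2).
have {}n1 : \forall n \near \oo, a n <= eps / 2.
  by apply: n1; rewrite divr_gt0.
near=> n; apply: QP => t At; apply: epsQ => /=.
rewrite ballEmdist /= metric_sym; apply: le_lt_trans (gf n t At) _.
apply: (@le_lt_trans _ _ (eps / 2)); first by near: n.
by rewrite ltr_pdivrMr// ltr_pMr// ltr1n.
Unshelve. all: by end_near. Qed.

(** Integer quotients of consecutive steps make all pairs of steps nested. *)
Lemma nested_steps (R : realType) (tau : nat -> R) :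
  (forall n, 0 < tau n) ->
  (forall n, exists k : nat, tau n / tau n.+1 = k%:R) ->
  forall n k, (n <= k)%N -> exists m : nat, tau n = m%:R * tau k.
Proof.
move=> tau0 hq n k /subnKC <-; elim: (k - n)%N => [|p [m IH]].
  by exists 1%N; rewrite addn0 mul1r.
have [q hq'] := hq (n + p)%N; exists (m * q)%N.
rewrite addnS natrM -hq' IH -mulrA divfK// gt_eqF//.
Qed.

Theorem theorem11 (R : realType) (X : completeMetricType R)
    (hsep : separable X)
    (E : X -> \bar R) (hE : forall w, (-oo < E w)%E)
    (hdom : domain E !=set0)
    (tau_max : R) (x_ref : X) (lambda : R) (htau_max : 0 < tau_max)
    (hE1 : seq_lower_semicontinuous E)
    (hE2 : (-oo < coercivity_constant E tau_max x_ref)%E)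
    (hE3 : bdf2_convex E lambda tau_max)
    (hlambda : lambda <= 0) (hlambda_tau : - lambda * tau_max <= 2^-1)
    (u0 : X) :
  exists C : R -> R -> R -> R -> R -> R,
  forall (tau : nat -> R) (um1_tau u0_tau : nat -> X) (K0 K1 K2 K3 : R),
    (forall n, 0 < tau n < tau_max) ->
    (forall n, tau n.+1 < tau n) ->
    tau n @[n --> \oo] --> (0 : R) ->
    (forall n, exists k : nat, tau n / tau n.+1 = k%:R) ->
    (forall n, mdist (u0_tau n) u0 <= K0 * tau n) ->
    (forall n, (E (u0_tau n) <= K1%:E)%E /\ (E (um1_tau n) <= K1%:E)%E) ->
    (forall n, mdist (um1_tau n) (u0_tau n) <= K2 * tau n) ->
    (forall n, mdist (u0_tau n) u0 <= K3 * tau n) ->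
    (forall n, exists! U : nat -> X,
       discrete_solution E (tau n) (um1_tau n) (u0_tau n) U) /\
    forall U : nat -> nat -> X,
      (forall n, discrete_solution E (tau n) (um1_tau n) (u0_tau n) (U n)) ->
      exists u : R -> X,
        [/\ AC2 u,
            gradient_flow E lambda u0 u,
            forall T : R, 0 < T ->
              {uniform `[0, T],
                 piecewise_constant (tau n) u0 (U n) @[n --> \oo] --> u} &
            forall T : R, 0 < T -> forall (n : nat) (t : R), 0 <= t <= T ->
              mdist (piecewise_constant (tau n) u0 (U n) t) (u t)
                <= C K0 K1 K2 K3 T * Num.sqrt (tau n)].
Proof.
(* The rate of [discrete_rate] with constants p = (K0, K1, K2, T); choosing C
   for each p first makes it independent of the sequences. *)
pose rate (p : R * R * R * R) (C : R) := 0 <= C /\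
  forall tau eta m um1 v0 U um1' v0' V,
  admissible E tau_max u0 p.1.1.1 p.1.1.2 p.1.2 tau um1 v0 ->
  admissible E tau_max u0 p.1.1.1 p.1.1.2 p.1.2 eta um1' v0' ->
  discrete_solution E tau um1 v0 U -> discrete_solution E eta um1' v0' V ->
  tau = m%:R * eta -> forall t, 0 <= t <= p.2 ->
  mdist (U (grid_index tau t)) (V (grid_index eta t)) <= C * Num.sqrt tau.
have /choice[C hC] : forall p, exists c, rate p c.
  move=> [[[K0 K1] K2] T].
  have [c c0 hc] := discrete_rate E lambda tau_max x_ref u0 hE hdom hE2 hE3
    htau_max hlambda hlambda_tau K0 K1 K2 T.
  by exists c.
exists (fun K0 K1 K2 _ T => C (K0, K1, K2, T)).
move=> tau um1 v0 K0 K1 K2 K3 htau _ tau_cvg hquot h0 h1 h2 _.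
have adm n : admissible E tau_max u0 K0 K1 K2 (tau n) (um1 n) (v0 n) by [].
have tau_gt0 n : 0 < tau n by have /andP[] := htau n.
split=> [n|U dU].
  have [d1 d0] := admissible_domain _ _ _ _ _ _ _ _ _ (adm n).
  exact: (discrete_solution_exists E lambda tau_max x_ref hE hdom hE1 hE2 hE3
    hlambda_tau).
have nested := nested_steps _ _ tau_gt0 hquot.
have sqrt_cvg c : c * Num.sqrt (tau n) @[n --> \oo] --> (0 : R).
  rewrite -(mulr0 c); apply: cvgMl_tmp; rewrite -sqrtr0.
  by apply: continuous_cvg => //; exact: sqrt_continuous.
have hrate T t n k : 0 <= t <= T -> (n <= k)%N ->
    mdist (U n (grid_index (tau n) t)) (U k (grid_index (tau k) t))
      <= C (K0, K1, K2, T) * Num.sqrt (tau n).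
  move=> tT nk; have [m hm] := nested _ _ nk.
  exact: ((hC (K0, K1, K2, T)).2 _ _ _ _ _ _ _ _ _ (adm n) (adm k) (dU n)
    (dU k) hm t tT).
have /choice[u hu] : forall t, exists z : X, (t <= 0 -> z = u0) /\
    (0 <= t -> U n (grid_index (tau n) t) @[n --> \oo] --> z).
  move=> t; have [t0|t0|->] := ltgtP t 0.
  - by exists u0; split => //; rewrite leNgt t0.
  - have [|z hz] := @cauchy_mdist_cvg _ _ (fun n => U n (grid_index (tau n) t)).
      move=> eps eps0; have e2 : 0 < eps / 2 by rewrite divr_gt0.
      have /cvgrPdist_lt/(_ _ e2)[N _ hN] := sqrt_cvg (C (K0, K1, K2, t)).
      exists N => n k Nn Nk.
      have tt : 0 <= t <= t by rewrite (ltW t0) lexx.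
      have := hN _ (leqnn N); rewrite sub0r normrN => /(le_lt_trans (ler_norm _)).
      move=> hlt; have h3 := hrate _ _ _ _ tt Nn; have h4 := hrate _ _ _ _ tt Nk.
      have := metric_triangle (U n (grid_index (tau n) t))
        (U N (grid_index (tau N) t)) (U k (grid_index (tau k) t)).
      rewrite [X in _ <= X + _]metric_sym; lra.
    by exists z; split => // tle; move: t0; rewrite ltNge tle.
  - exists u0; split=> // _; apply/cvg_mdistP.
    apply: (@squeeze_cvgr _ _ _ _ (fun=> 0) (fun n => K0 * tau n)).
    + apply: nearW => n; rewrite mdist_ge0 /=.
      have [U0 _] := dU n.
      by rewrite /grid_index mul0r ceil0 absz0 U0.
    + exact: cvg_cst.
    + by rewrite -(mulr0 K0); apply: cvgMl_tmp.
have hu0 t : t <= 0 -> u t = u0 by have [] := hu t.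
have hu1 t : 0 <= t -> U n (grid_index (tau n) t) @[n --> \oo] --> u t.
  by have [] := hu t.
have herr T n t : 0 <= t <= T ->
    mdist (piecewise_constant (tau n) u0 (U n) t) (u t)
      <= C (K0, K1, K2, T) * Num.sqrt (tau n).
  move=> tT; have /andP[t0 _] := tT; rewrite /piecewise_constant.
  have [t_le0|t_gt0] := leP t 0.
    rewrite hu0// mdistxx mulr_ge0 ?sqrtr_ge0//.
    by have [] := hC (K0, K1, K2, T).
  apply: (@ler_cvgn _ (fun k => mdist (U n (grid_index (tau n) t))
    (U k (grid_index (tau k) t)))
    (fun=> C (K0, K1, K2, T) * Num.sqrt (tau n))).
  - by apply: cvg_mdist; [exact: cvg_cst|exact: hu1].
  - exact: cvg_cst.
  - by exists n => // k /= nk; exact: hrate.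
exists u; split.
- have contr := limit_contraction E lambda tau_max x_ref u0 hE hdom hE2 hE3
    htau_max hlambda hlambda_tau tau um1 v0 U K0 K1 K2 u adm tau_cvg dU hu1.
  have energy := limit_path_energy E lambda tau_max x_ref u0 hE hdom hE2 hE3
    htau_max hlambda hlambda_tau tau um1 v0 U K0 K1 K2 u adm tau_cvg dU hu1.
  have cont := limit_continuous E lambda tau_max x_ref u0 hE hdom hE2 hE3
    htau_max hlambda hlambda_tau tau um1 v0 U K0 K1 K2 u adm tau_cvg dU hu1 hu0.
  apply: (AC2_of_contraction u (12 * - lambda)) => //.
  by rewrite mulr_ge0// oppr_ge0.
- split; first exact: hu0.
  move=> s t w; exact: (limit_evi E lambda tau_max x_ref u0 hE hdom hE1 hE2 hE3
    htau_max hlambda hlambda_tau tau um1 v0 U K0 K1 K2 u adm tau_cvg dU hu1 hu0).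
- move=> T T0; apply: cvg_uniform_mdist (sqrt_cvg (C (K0, K1, K2, T))) _.
  by move=> n t /=; rewrite in_itv /=; exact: herr.
- by move=> T _ n t; exact: herr.
Qed.
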